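(* Let $X$, $Y$ and $A$ be uniform ARs [respectively, uniform ANRs], where $A$ is a closed subset of $X$, and let $f\colon A\to Y$ be a uniformly continuous map. Then the adjunction space $X\cup_f Y$ is a uniform AR [respectively, a uniform ANR].
   Context: A uniform AR [uniform ANR] is a metrizable uniform space $Y$ such that for every uniform embedding $i$ of $Y$ onto a closed subspace of a metrizable uniform space $Z$ there exists a uniformly continuous retraction of $Z$ [respectively, of some uniform neighborhood of $i(Y)$ in $Z$, i.e. a set containing an $\varepsilon$-neighborhood of $i(Y)$ for some $\varepsilon>0$] onto $i(Y)$. The subset $A$ carries the subspace uniformity. The adjunction space $X\cup_f Y$ is the quotient of the uniform disjoint union $X\sqcup Y$ by the equivalence relation generated by $a\sim f(a)$, $a\in A$, with the quotient uniformity, i.e. the finest pre-uniformity making the quotient map uniformly continuous (its uniform covers are those covers $C_1$ that belong to a sequence $C_1,C_2,\dots$ of covers of $X\cup_f Y$ such that each $C_{i+1}$ barycentrically refines $C_i$ and the preimage of each $C_i$ in $X\sqcup Y$ is a uniform cover). *)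

(* Defs.v *)
From HB Require Import structures.
From Stdlib Require Import Relation_Operators.
From mathcomp Require Import all_boot all_order all_algebra.
From mathcomp Require Import all_classical all_reals all_analysis.

Set Implicit Arguments.
Unset Strict Implicit.
Unset Printing Implicit Defensive.

Import Order.TTheory GRing.Theory Num.Theory.
Local Open Scope classical_set_scope.
Local Open Scope ring_scope.

(* A [uniformType] need not be Hausdorff: it is a set with a pre-uniformity.
   The Hausdorff condition is part of metrizability below. *)

Record compatible_metric (R : realType) (T : uniformType) (d : T -> T -> R) :
    Prop := CompatibleMetric {
  cmetric_eq0 : forall x y, d x y = 0 <-> x = y ;
  cmetric_sym : forall x y, d x y = d y x ;
  cmetric_triangle : forall x y z, d x z <= d x y + d y z ;
  cmetric_entourage :
    @entourage T = entourage_ (fun x (e : R) => [set y | d x y < e])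
}.

Definition metrizable_uniform (R : realType) (T : uniformType) : Prop :=
  exists d : T -> T -> R, compatible_metric d.

Lemma metricType_metrizable (R : realType) (T : metricType R) :
  metrizable_uniform R T.
Proof.
exists (@mdist R T); split.
- by move=> x y; split=> [|->]; [exact: mdist_positivity|exact: mdistxx].
- exact: metric_sym.
- by move=> x y z; exact: metric_triangle.
- rewrite -entourage_ballE; congr entourage_.
  by apply/funext => x; apply/funext => e; exact: ballEmdist.
Qed.

(* [range i] and every other subset carry the subspace uniformity, which the
   library puts on [set_type]. *)
Definition uniform_embedding (Y Z : uniformType) (i : Y -> Z) : Prop :=
  [/\ injective i, unif_continuous i &
      exists2 g : range i -> Y, unif_continuous g &
        forall u : range i, i (g u) = set_val u].

Definition uniform_retraction (T : uniformType) (B : set T) (r : T -> B) :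
  Prop := unif_continuous r /\ forall b : B, r (set_val b) = b.

Definition uniform_nbhd (R : realType) (Z : uniformType) (B U : set Z) : Prop :=
  exists (d : Z -> Z -> R) (e : R), [/\ compatible_metric d, 0 < e &
    forall b z, B b -> d b z < e -> U z].

Definition uniform_AR (R : realType) (Y : uniformType) : Prop :=
  metrizable_uniform R Y /\
  forall (Z : uniformType) (i : Y -> Z),
    metrizable_uniform R Z -> uniform_embedding i -> closed (range i) ->
    exists r : Z -> range i, uniform_retraction r.

(* For a uniform neighborhood [U], the set [set_val @^-1` range i] is
   [range i] seen as a subset of the subspace [U]. *)
Definition uniform_ANR (R : realType) (Y : uniformType) : Prop :=
  metrizable_uniform R Y /\
  forall (Z : uniformType) (i : Y -> Z),
    metrizable_uniform R Z -> uniform_embedding i -> closed (range i) ->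
    exists2 U : set Z, uniform_nbhd R (range i) U &
      exists r : U -> (set_val @^-1` range i : set U), uniform_retraction r.

Section uniform_sum.
Variables X Y : uniformType.
Local Open Scope relation_scope.

Definition sum_ent : set_system ((X + Y) * (X + Y)) :=
  [set E | entourage [set p : X * X | E (inl p.1, inl p.2)] /\
           entourage [set p : Y * Y | E (inr p.1, inr p.2)]].

Let sum_ent_filter : Filter sum_ent.
Proof.
split.
- by split; exact: filterT.
- by move=> P Q [PX PY] [QX QY]; split; exact: filterI.
- by move=> P Q PQ [PX PY]; split; [apply: filterS PX|apply: filterS PY];
    move=> ? /PQ.
Qed.

Let sum_ent_diagonal E : sum_ent E -> diagonal `<=` E.
Proof.
move=> [EX EY] [u v] /diagonalP ->; case: v => [x|y].
  exact: (entourage_refl x EX).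
exact: (entourage_refl y EY).
Qed.

Let sum_ent_inv E : sum_ent E -> sum_ent E^-1.
Proof. by move=> [/entourage_inv EX /entourage_inv EY]; split. Qed.

Let sum_ent_split E : sum_ent E -> exists2 B, sum_ent B & B \; B `<=` E.
Proof.
move=> [/entourage_split_ex[B1 B1e B1E] /entourage_split_ex[B2 B2e B2E]].
exists [set p | match p with
                | (inl x, inl x') => B1 (x, x')
                | (inr y, inr y') => B2 (y, y')
                | _ => False
                end].
  by split; [apply: filterS B1e|apply: filterS B2e]; case.
move=> [[x|y] [x'|y']] [[z|z]] //= h1 h2.
  by apply: (B1E (x, x')); exists z.
by apply: (B2E (y, y')); exists z.
Qed.

HB.instance Definition _ := isUniform.Build (X + Y)%type
  sum_ent_filter sum_ent_diagonal sum_ent_inv sum_ent_split.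

End uniform_sum.

(* In general the topology of the quotient uniformity is coarser than
   [quotient_topology]. *)
Definition uniform_quotient (T : Type) (Q : quotType T) : Type := Q.

Section uniform_quotient.
Local Open Scope quotient_scope.
Local Open Scope relation_scope.
Variables (T : uniformType) (Q0 : quotType T).
Local Notation Q := (uniform_quotient Q0).

HB.instance Definition _ := Quotient.copy Q Q0.
HB.instance Definition _ := [Sub Q of T by %/].
HB.instance Definition _ := [Choice of Q by <:].

(* The entourage form of the description by sequences of covers;
   [uniform_quotient_continuous] below is the universal property, so that
   this is the finest uniformity making \pi uniformly continuous. *)
Definition quotient_ent : set_system (Q * Q) :=
  [set E | exists S : nat -> set (Q * Q), [/\ S 0%N = E,
     forall n, S n.+1 \; S n.+1 `<=` S n &
     forall n, entourage [set p : T * T | S n (\pi_Q p.1, \pi_Q p.2)]]].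

Let quotient_ent_filter : Filter quotient_ent.
Proof.
split.
- by exists (fun=> setT); split=> // n; exact: filterT.
- move=> P P' [S [<- S2 Se]] [S' [<- S2' Se']].
  exists (fun n => S n `&` S' n); split=> // n.
    move=> [x y] [z [h1 h1'] [h2 h2']].
    by split; [apply: S2; exists z|apply: S2'; exists z].
  exact: (filterI (Se n) (Se' n)).
- move=> P P' PP' [S [SP S2 Se]].
  exists (fun n => if n is 0%N then P' else S n); split=> //.
    by move=> [|n] //; apply: subset_trans (S2 0%N) _; rewrite SP.
  move=> [|n] //; apply: filterS (Se 0%N); rewrite SP.
  by move=> ? /PP'.
Qed.

Let quotient_ent_diagonal E : quotient_ent E -> diagonal `<=` E.
Proof.
move=> [S [<- _ Se]] [u v] /diagonalP ->.
by have := entourage_refl (repr v) (Se 0%N); rewrite /= reprK.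
Qed.

Let quotient_ent_inv E : quotient_ent E -> quotient_ent E^-1.
Proof.
move=> [S [<- S2 Se]]; exists (fun n => (S n)^-1); split=> // n.
  by move=> [x y] [z h1 h2]; apply: (S2 n (y, x)); exists z.
exact: entourage_inv (Se n).
Qed.

Let quotient_ent_split E :
  quotient_ent E -> exists2 B, quotient_ent B & B \; B `<=` E.
Proof.
by move=> [S [<- S2 Se]]; exists (S 1%N) => //; exists (fun n => S n.+1).
Qed.

HB.instance Definition _ := isUniform.Build Q
  quotient_ent_filter quotient_ent_diagonal quotient_ent_inv quotient_ent_split.

Lemma pi_unif_continuous : unif_continuous (\pi_Q : T -> Q).
Proof. by move=> E [S [<- _ Se]]; exact: Se 0%N. Qed.

Lemma uniform_quotient_continuous (V : uniformType) (g : Q -> V) :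
  unif_continuous g <-> unif_continuous (g \o \pi_Q).
Proof.
split=> [gc E /gc|gc E Ee]; first exact: pi_unif_continuous.
pose S := fix S n := if n is m.+1 then split_ent (S m) else E.
have Sn n : entourage (S n) by elim: n => //= n; exact: entourage_split_ent.
exists (fun n => [set p | S n (g p.1, g p.2)]); split=> // n.
  move=> [x y] [z /= h1 h2]; exact: (entourage_split (g z) (Sn n) h1 h2).
exact: gc (Sn n).
Qed.

End uniform_quotient.

Section adjunction.
Local Open Scope quotient_scope.
Variables (X Y : uniformType) (A : set X) (f : A -> Y).

Definition glue (u v : X + Y) : Prop :=
  exists a : A, u = inl (set_val a) /\ v = inr (f a).

Definition glue_equiv (u v : X + Y) : bool :=
  `[< clos_refl_sym_trans (X + Y)%type glue u v >].

Let glue_equiv_refl : reflexive glue_equiv.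
Proof. by move=> u; apply/asboolP; exact: rst_refl. Qed.

Let glue_equiv_sym : symmetric glue_equiv.
Proof. by move=> u v; apply/idP/idP => /asboolP h; apply/asboolP/rst_sym. Qed.

Let glue_equiv_trans : transitive glue_equiv.
Proof.
move=> v u w /asboolP h1 /asboolP h2.
by apply/asboolP; exact: rst_trans h1 h2.
Qed.

Canonical glue_equivRel :=
  EquivRel glue_equiv glue_equiv_refl glue_equiv_sym glue_equiv_trans.

Definition adjunction_space : uniformType :=
  uniform_quotient {eq_quot glue_equivRel}.

End adjunction.

(* Main.v *)
Require Import Defs.
From HB Require Import structures.
From Stdlib Require Import Relation_Operators.
From mathcomp Require Import all_boot all_order all_algebra.
From mathcomp Require Import all_classical all_reals all_analysis.
From mathcomp Require Import ring lra.

(** Let [S] be [X + Y] with a pseudometric of the adjunction space.  A metrizable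
    uniform space is an absolute (neighbourhood) retract exactly when it has the
    corresponding extension property for uniformly continuous maps on closed
    subsets: a map [f] from a closed [B] in [Z] to [Y] extends because [Y] is a
    retract of the space obtained by gluing [Z] to [Y] along [f]
    ([absolute_retract_extends], and [extensor_absolute_retract] for the
    converse).  So the task is to extend a map [g] from a closed [B] in [Z] to
    [S], and the hypotheses become extension properties of [X], [A] and [Y].

    After a change of the metric of [X], [f] does not increase distances
    ([remetrize]), and [S] is metrized by the shorter of the direct path and the
    path through [Y] ([glue_dist]); the quotient uniformity is the one of this
    metric ([adjunction_dist_metrizes]).  At distance more than [r] from [Y] the
    gluing changes no distance below [r] ([glue_dist_far]).

    The extension properties of [A] and [X] give a retraction of a neighbourhood
    of [A] to [A] and a deformation of the neighbourhood to this retraction, fixed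
    on [A] ([deformation]).  It induces a deformation of a neighbourhood of [Y] in
    [S] into [Y], fixed on [Y].

    Let [t] be an extension to [Z] of the distance from [g] to [Y].  Where [t] is
    positive [g] is a map to [X], but its modulus of continuity into [X] degrades
    as [t] tends to 0.  It is uniformly continuous for the metric
    [ln (1 + d / min t t')], so it extends to a map [x] on the part of a
    neighbourhood of [B] where [t] is positive, with control relative to [t]
    ([glue_relative_extensor]).  On the collar [sdist B z <= k * t z ^ 2], which is
    thin compared to [t], this control makes [x] tend to [g] as [t] tends to 0, so
    that [x] is uniformly continuous there ([collar_uc]).  Outside the collar there
    is no such control; therefore [x] is pushed into [Y] along the deformation
    while the collar is crossed, and the resulting map to [Y] is extended by means
    of the extension property of [Y] ([collar_extends]).

    The absolute and the neighbourhood version are treated together: a boolean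
    [b] is true for the absolute one. *)

Set Implicit Arguments.
Unset Strict Implicit.
Unset Printing Implicit Defensive.

Import Order.TTheory GRing.Theory Num.Theory.
Local Open Scope classical_set_scope.
Local Open Scope ring_scope.

(** * Infima capped at one *)

Section CappedInfimum.
Variable R : realType.

(** The cap keeps the infimum over an empty family equal to 1, the largest value
    of the bounded metrics used below. *)
Definition cinf (I : Type) (P : I -> Prop) (h : I -> R) : R :=
  inf [set r | r = 1 \/ exists2 i, P i & r = h i].

Section cinf_lemmas.
Variables (I : Type) (P : I -> Prop) (h : I -> R).

Lemma cinf_ge c : c <= 1 -> (forall i, P i -> c <= h i) -> c <= cinf P h.
Proof.
move=> c1 ch; apply: lb_le_inf; first by exists 1; left.
by move=> r [->|[i Pi ->]] //; exact: ch.
Qed.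

Lemma cinf_lt r : r <= 1 -> cinf P h < r -> exists2 i, P i & h i < r.
Proof.
move=> r1; apply: contraPP => no; apply/negP; rewrite -leNgt.
apply: cinf_ge => // i Pi; rewrite leNgt; apply/negP => hr.
by apply: no; exists i.
Qed.

Hypothesis h0 : forall i, P i -> 0 <= h i.

Let lb : has_lbound [set r | r = 1 \/ exists2 i, P i & r = h i].
Proof. by exists 0 => r [->|[i Pi ->]]; [exact: ler01|exact: h0]. Qed.

Lemma cinf_le1 : cinf P h <= 1.
Proof. by apply: ge_inf => //; left. Qed.

Lemma cinf_le i : P i -> cinf P h <= h i.
Proof. by move=> Pi; apply: ge_inf => //; right; exists i. Qed.

Lemma cinf_ge0 : 0 <= cinf P h.
Proof. by apply: cinf_ge. Qed.

End cinf_lemmas.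
End CappedInfimum.

(** * Metrics *)

Section Metrics.
Variable R : realType.

Record pmetric (T : Type) (d : T -> T -> R) : Prop := Pmetric {
  pm_xx : forall x, d x x = 0 ;
  pm_sym : forall x y, d x y = d y x ;
  pm_tri : forall y x z, d x z <= d x y + d y z }.

Definition definite (T : Type) (d : T -> T -> R) :=
  forall x y, d x y = 0 -> x = y.

(** Maps are total and restricted to sets, so that values off the set of interest
    can be chosen freely. *)
Definition uc_on (Z T : Type) (dZ : Z -> Z -> R) (dT : T -> T -> R)
    (B : set Z) (g : Z -> T) :=
  forall e, 0 < e -> exists2 del, 0 < del &
    forall z z', B z -> B z' -> dZ z z' < del -> dT (g z) (g z') < e.

Lemma pm_ge0 T (d : T -> T -> R) x y : pmetric d -> 0 <= d x y.
Proof.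
move=> dm; have := pm_tri dm y x x.
by rewrite (pm_xx dm) (pm_sym dm y x); lra.
Qed.

Lemma pm_quad T (d : T -> T -> R) x' y' x y : pmetric d ->
  d x y <= d x x' + d x' y' + d y' y.
Proof.
by move=> dm; have := pm_tri dm y' x y; have := pm_tri dm x' x y'; lra.
Qed.

Lemma pm_eq0 T (d : T -> T -> R) x' y' x y : pmetric d ->
  d x' x = 0 -> d y' y = 0 -> d x' y' = d x y.
Proof.
move=> dm xx yy; have := pm_quad x y x' y' dm; have := pm_quad x' y' x y dm.
by rewrite (pm_sym dm x x') (pm_sym dm y y') xx yy; lra.
Qed.

(** A modulus of continuity can be absorbed into the metric: the concave
    majorant of the modulus, an infimum of affine functions, is subadditive,
    so that composing it with the metric gives a metric. *)
Lemma remetrize (T I : Type) (d : T -> T -> R) (j : I -> T) (k : I -> I -> R) :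
  pmetric d -> definite d -> (forall i i', k i i' <= 1) ->
  (forall e, 0 < e -> exists2 del, 0 < del &
    forall i i', d (j i) (j i') < del -> k i i' < e) ->
  exists d' : T -> T -> R, [/\ pmetric d' /\ definite d',
    forall x y, d' x y <= 1,
    uc_on d d' setT id, uc_on d' d setT id &
    forall i i', k i i' <= d' (j i) (j i')].
Proof.
move=> dm dd k1 kuc.
(* The pairs of constant term and slope of the affine majorants of the modulus of
   continuity. *)
pose P (p : R * R) := [/\ 0 <= p.1, 0 <= p.2 &
  forall i i', k i i' <= p.1 + p.2 * d (j i) (j i')].
pose w s := cinf P (fun p => p.1 + p.2 * s).
have d0 x y := pm_ge0 x y dm.
have P0 s : 0 <= s -> forall p, P p -> 0 <= p.1 + p.2 * s.
  by move=> s0 p [p1 p2 _]; rewrite addr_ge0 // mulr_ge0.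
have w0 s : 0 <= s -> 0 <= w s by move=> s0; exact: cinf_ge0 (P0 _ s0).
have w1 s : 0 <= s -> w s <= 1 by move=> s0; exact: cinf_le1 (P0 _ s0).
have wD s s1 s2 : 0 <= s -> 0 <= s1 -> 0 <= s2 -> s <= s1 + s2 ->
    w s <= w s1 + w s2.
  move=> s0 s10 s20 ss; rewrite leNgt; apply/negP => gap.
  (* Of two majorants, the one with the smaller slope bounds the value at [s]. *)
  have := w1 _ s0; have := w0 _ s10; have := w0 _ s20 => h1 h2 h3.
  have [p Pp plt] : exists2 p, P p & p.1 + p.2 * s1 < w s1 + (w s - w s1 - w s2) / 2.
    by apply: cinf_lt; rewrite -/(w s1); lra.
  have [q Pq qlt] : exists2 p, P p & p.1 + p.2 * s2 < w s2 + (w s - w s1 - w s2) / 2.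
    by apply: cinf_lt; rewrite -/(w s2); lra.
  have wp := cinf_le (P0 _ s0) Pp; have wq := cinf_le (P0 _ s0) Pq.
  rewrite -/(w s) in wp wq.
  case: (Pp) (Pq) => p1 p2 _ [q1 q2 _].
  have [pq|qp] := leP p.2 q.2.
    have : p.2 * s <= p.2 * s1 + q.2 * s2.
      apply: le_trans (_ : p.2 * (s1 + s2) <= _); first exact: ler_wpM2l.
      by rewrite mulrDr lerD2l ler_wpM2r.
    lra.
  have : q.2 * s <= p.2 * s1 + q.2 * s2.
    apply: le_trans (_ : q.2 * (s1 + s2) <= _); first exact: ler_wpM2l.
    by rewrite mulrDr lerD2r ler_wpM2r // ltW.
  lra.
have wk i i' : k i i' <= w (d (j i) (j i')) by apply: cinf_ge => // p [].
have w00 : w 0 = 0.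
  apply/eqP; rewrite eq_le w0 // andbT leNgt; apply/negP => w0gt.
  have w01 := w1 0 (lexx _).
  have [del del0 kdel] := kuc _ (divr_gt0 w0gt (ltr0n _ 2)).
  have : w 0 <= w 0 / 2 + del^-1 * 0.
    apply: (@cinf_le _ _ P _ (P0 0 (lexx _)) (w 0 / 2, del^-1)).
    split => /= [||i i']; [lra | by rewrite invr_ge0 ltW|].
    have [dl|dl] := ltP (d (j i) (j i')) del.
      apply: le_trans (ltW (kdel _ _ dl)) _.
      by rewrite lerDl mulr_ge0 // invr_ge0 ltW.
    apply: le_trans (k1 _ _) _.
    have : 1 <= del^-1 * d (j i) (j i') by rewrite mulrC ler_pdivlMr // mul1r.
    lra.
  lra.
exists (fun x y => Num.min 1 (d x y + w (d x y))); split.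
- split; last first.
    move=> x y; have := d0 x y; have := w0 _ (d0 x y); set a := w _.
    move=> a0 b0; case: (leP 1 (d x y + a)) => _ h; first by exfalso; lra.
    by apply: dd; lra.
  split=> [x|x y|y x z].
  + by rewrite (pm_xx dm) w00 addr0; apply/min_r/ler01.
  + by rewrite (pm_sym dm).
  + have := pm_tri dm y x z => t1.
    have := wD _ _ _ (d0 x z) (d0 x y) (d0 y z) t1 => t2.
    have := d0 x z; have := d0 x y; have := d0 y z.
    have := w0 _ (d0 x z); have := w0 _ (d0 x y); have := w0 _ (d0 y z).
    by case: (leP 1 (d x z + _)); case: (leP 1 (d x y + _));
      case: (leP 1 (d y z + _)); lra.
- by move=> x y; rewrite ge_min lexx.
- move=> e e0; have e3 : 0 < e / 3 by rewrite divr_gt0.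
  have [del del0 kdel] := kuc _ e3.
  exists (Num.min (e / 3) (del * (e / 3))) => [|x y _ _ /=].
    by rewrite lt_min e3 mulr_gt0.
  rewrite lt_min => /andP[h1 h2]; rewrite gt_min; apply/orP; right.
  have : w (d x y) <= e / 3 + del^-1 * d x y.
    apply: (@cinf_le _ _ P _ (P0 _ (d0 x y)) (e / 3, del^-1)).
    split => /= [||i i']; [lra | by rewrite invr_ge0 ltW|].
    have [dl|dl] := ltP (d (j i) (j i')) del.
      apply: le_trans (ltW (kdel _ _ dl)) _.
      by rewrite lerDl mulr_ge0 // invr_ge0 ltW.
    apply: le_trans (k1 _ _) _.
    have : 1 <= del^-1 * d (j i) (j i') by rewrite mulrC ler_pdivlMr // mul1r.
    lra.
  have : del^-1 * d x y < e / 3 by rewrite mulrC ltr_pdivrMr // mulrC.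
  lra.
- move=> e e0; exists (Num.min e 1) => [|x y _ _ /=]; first by rewrite lt_min e0 ltr01.
  rewrite lt_min !gt_min ltxx => /andP[+ /= +].
  by have := w0 _ (d0 x y); case: (ltP 1 e); lra.
- by move=> i i'; rewrite le_min k1 (le_trans (wk _ _)) // lerDr.
Qed.

End Metrics.

Section DistanceToSet.
Variable R : realType.
Variables (T : Type) (d : T -> T -> R).

Definition sdist (B : set T) (z : T) : R := cinf B (d z).

Definition mclosed (B : set T) :=
  forall z, (forall e, 0 < e -> exists2 b, B b & d z b < e) -> B z.

Lemma sdist_lt B z r : r <= 1 -> sdist B z < r -> exists2 b, B b & d z b < r.
Proof. exact: cinf_lt. Qed.

Hypothesis dm : pmetric d.
Variable B : set T.

Let d0 z b : B b -> 0 <= d z b. Proof. by move=> _; exact: pm_ge0. Qed.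

Lemma sdist_le1 z : sdist B z <= 1.
Proof. exact: cinf_le1 (d0 z). Qed.

Lemma sdist_ge0 z : 0 <= sdist B z.
Proof. exact: cinf_ge0 (d0 z). Qed.

Lemma sdist_le z b : B b -> sdist B z <= d z b.
Proof. exact: cinf_le (d0 z) _. Qed.

Lemma sdist_in b : B b -> sdist B b = 0.
Proof.
by move=> /(sdist_le b); have := sdist_ge0 b; rewrite (pm_xx dm); lra.
Qed.

Lemma sdist_lip z z' : sdist B z <= d z z' + sdist B z'.
Proof.
rewrite -lerBlDl; apply: cinf_ge => [|b Bb].
  by have := sdist_le1 z; have := pm_ge0 z z' dm; lra.
by have := sdist_le z Bb; have := pm_tri dm z' z b; lra.
Qed.

Lemma sdist_eq0 z : mclosed B -> sdist B z = 0 -> B z.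
Proof.
move=> Bc z0; apply: Bc => e e0.
have [b Bb zb] : exists2 b, B b & d z b < Num.min e 1.
  by apply: sdist_lt; [rewrite ge_min lexx orbT|rewrite z0 lt_min e0 ltr01].
by exists b => //; apply: lt_le_trans zb _; rewrite ge_min lexx.
Qed.

End DistanceToSet.

(** * Extension of maps across a collar *)

Section Extension.
Variable R : realType.

(** For [b] true this is the whole space, so that the absolute and the
    neighbourhood versions of the results have a common form. *)
Definition mnbhd (b : bool) (Z : Type) (dZ : Z -> Z -> R) (B : set Z) (e : R) :
  set Z := [set z | b \/ exists2 y, B y & dZ z y < e].

(** The extension agrees with [g] up to distance 0 only, because [dT] may be the
    pseudometric of a space before identification. *)
Definition extends_to (b : bool) (Z T : Type) (dZ : Z -> Z -> R)
    (dT : T -> T -> R) (A : set T) (B : set Z) (g : Z -> T) :=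
  exists (G : Z -> T) (e : R), [/\ 0 < e, forall z, B z -> dT (G z) (g z) = 0,
    uc_on dZ dT (mnbhd b dZ B e) G & forall z, mnbhd b dZ B e z -> A (G z)].

(** The inhabitant of [A] is the extension from the empty set; it is stated apart
    because [g] is total, so that an empty [T] would make the second part vacuous
    for inhabited [Z]. *)
Definition extensor (b : bool) (T : Type) (dT : T -> T -> R) (A : set T) : Prop :=
  (b -> exists a, A a) /\
  forall (Z : Type) (dZ : Z -> Z -> R) (B : set Z) (g : Z -> T),
    pmetric dZ -> definite dZ -> mclosed dZ B -> uc_on dZ dT B g ->
    (forall z, B z -> A (g z)) -> extends_to b dZ dT A B g.

(** By [remetrize], uniformly continuous maps may be taken to be 1-Lipschitz. *)
Lemma extensor_lipschitz (b : bool) (T : Type) (dT : T -> T -> R) (A : set T) :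
  (forall x y, dT x y <= 1) -> (b -> exists a, A a) ->
  (forall (Z : Type) (dZ : Z -> Z -> R) (B : set Z) (g : Z -> T),
    pmetric dZ -> definite dZ -> (forall z z', dZ z z' <= 1) -> mclosed dZ B ->
    (forall z z', B z -> B z' -> dT (g z) (g z') <= dZ z z') ->
    (forall z, B z -> A (g z)) -> extends_to b dZ dT A B g) ->
  extensor b dT A.
Proof.
move=> dT1 An H; split => // Z dZ B g dm dd Bc guc gA.
have [|| d' [[dm' dd'] d'1 dd1 dd2 gL]] :=
  @remetrize R Z {z | B z} dZ (fun z => sval z)
    (fun z z' => dT (g (sval z)) (g (sval z'))) dm dd.
- by move=> *; exact: dT1.
- move=> e /guc[del del0 h]; exists del => // -[z Bz] [z' Bz'] /=; exact: h.
have Bc' : mclosed d' B.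
  move=> z hz; apply: Bc => e /dd2[del del0 h]; have [b' Bb zb] := hz _ del0.
  by exists b' => //; apply: h.
have gL' z z' : B z -> B z' -> dT (g z) (g z') <= d' z z'.
  by move=> Bz Bz'; exact: (gL (exist _ z Bz) (exist _ z' Bz')).
have [G [e [e0 GB Guc GA]]] := H Z d' B g dm' dd' d'1 Bc' gL' gA.
have [e1 e10 he1] := dd1 _ e0.
have sub z : mnbhd b dZ B e1 z -> mnbhd b d' B e z.
  by move=> [?|[y By zy]]; [left|right; exists y => //; exact: he1].
exists G, e1; split=> // [e2 /Guc[del del0 h]|z /sub/GA//].
have [del' del'0 h'] := dd1 _ del0.
by exists del' => // z z' /sub Uz /sub Uz' zz'; apply: h => //; exact: h'.
Qed.

Lemma extensor_weaken (T : Type) (dT : T -> T -> R) (A : set T) (b : bool) :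
  extensor b dT A -> extensor false dT A.
Proof.
move=> [_ H]; split => // Z dZ B g dm dd Bc guc gA.
have [G [e [e0 GB Guc GA]]] := H Z dZ B g dm dd Bc guc gA.
have sub z : mnbhd false dZ B e z -> mnbhd b dZ B e z by move=> [//|?]; right.
exists G, e; split=> // [e2 /Guc[del del0 h]|z /sub/GA//].
by exists del => // z z' /sub Uz /sub Uz'; exact: h.
Qed.

Definition clamp (r : R) : R := Num.max 0 (Num.min 1 r).

Variant clamp_spec (r : R) : R -> Prop :=
  | Clamp0 of r <= 0 : clamp_spec r 0
  | Clamp1 of 1 <= r : clamp_spec r 1
  | ClampId of 0 < r & r < 1 : clamp_spec r r.

Lemma clampP r : clamp_spec r (clamp r).
Proof.
rewrite /clamp; case: (leP 1 r) => r1.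
  by rewrite max_r ?ler01 //; apply: Clamp1.
by case: (leP 0 r) => r0; [|apply: Clamp0; exact: ltW];
  move: r0; rewrite le_eqVlt => /predU1P[<-|]; [exact: Clamp0|move=> rp; exact: ClampId].
Qed.

Lemma clamp_lip r r' : `|clamp r - clamp r'| <= `|r - r'|.
Proof.
have h1 : r - r' <= `|r - r'| := ler_norm _.
have h2 : - (r - r') <= `|r - r'| by rewrite -normrN; exact: ler_norm.
by rewrite ler_norml; case: (clampP r); case: (clampP r'); lra.
Qed.

(** The width of the collar is quadratic in [t]: a step from the collar to [B] is
    then arbitrarily small in proportion to [t] when [t] is small. *)
Definition collar (Z : Type) (d : Z -> Z -> R) (B : set Z) (t : Z -> R) (k : R) :
  set Z := [set z | sdist d B z <= k * t z ^+ 2].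

(** An almost nearest point of [B] is so close that [t] is still comparable there. *)
Lemma collar_base (Z : Type) (d : Z -> Z -> R) (B : set Z) (t : Z -> R) (k : R) z :
  (forall z z', t z <= d z z' + t z') -> (forall z, 0 <= t z <= 1) ->
  0 < k <= 4^-1 -> collar d B t k z -> 0 < t z ->
  exists y, [/\ B y, d z y < 2 * (k * t z ^+ 2) & t z / 2 < t y].
Proof.
move=> tL t01 /andP[k0 k4] Vz tz; have /andP[t0 t1] := t01 z.
have T0 : 0 < t z ^+ 2 by rewrite exprn_gt0.
have T1 : t z ^+ 2 <= t z by rewrite expr2 ler_piMr.
have kT : k * t z ^+ 2 <= 4^-1 * t z ^+ 2 by rewrite ler_wpM2r // ltW.
have kT0 : 0 < k * t z ^+ 2 by rewrite mulr_gt0.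
have [y By zy] : exists2 y, B y & d z y < 2 * (k * t z ^+ 2).
  by apply: sdist_lt; [lra|move: Vz; rewrite /collar /=; lra].
by exists y; split => //; have := tL z y; lra.
Qed.

(** 0 on the inner half of the collar and 1 at its boundary; where [t] vanishes
    the division by 0 gives time 0, as it should since the collar is reduced to
    [B] there. *)
Definition collar_time (Z : Type) (d : Z -> Z -> R) (B : set Z) (t : Z -> R)
    (k : R) (z : Z) : R :=
  clamp (2 * (sdist d B z / (k * t z ^+ 2)) - 1).

(** The extension property of the complement of the set whose distance function is
    [rho].  As [g] may behave badly in this complement near that set, the extension
    is controlled only at scales proportional to [t], which extends [rho \o g]. *)
Definition relative_extensor (S : Type) (D : S -> S -> R) (rho : S -> R) :=
  forall (Z : Type) (d : Z -> Z -> R) (B : set Z) (t : Z -> R) (g : Z -> S),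
    pmetric d -> definite d -> (forall z z', d z z' <= 1) -> mclosed d B ->
    (forall z z', t z <= d z z' + t z') -> (forall z, 0 <= t z <= 1) ->
    (forall z z', B z -> B z' -> D (g z) (g z') <= d z z') ->
    (forall z, B z -> t z = rho (g z)) ->
    exists (k : R) (x : Z -> S), [/\ 0 < k <= 4^-1,
      forall z, B z -> 0 < t z -> x z = g z &
      forall e, 0 < e -> exists2 del, 0 < del & forall z z',
        collar d B t k z -> collar d B t k z' -> 0 < t z -> 0 < t z' ->
        d z z' < del * t z -> d z z' < del * t z' -> D (x z) (x z') < e].

Section collar.
Variables (S : Type) (D : S -> S -> R) (Y0 : set S) (b : bool).
Local Notation rho := (sdist D Y0).
Variables (N : set S) (H : S -> R -> S).
Hypotheses (Dm : pmetric D) (D1 : forall u v, D u v <= 1).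
Hypotheses (Nb : b -> N = setT)
  (Nrho : exists2 c, 0 < c & forall u, rho u < c -> N u).
Hypothesis Huc : forall e, 0 < e -> exists2 del, 0 < del &
  forall u u' s s', N u -> N u' -> 0 <= s <= 1 -> 0 <= s' <= 1 ->
    D u u' < del -> `|s - s'| < del -> D (H u s) (H u' s') < e.
Hypotheses (H0 : forall u, H u 0 = u) (H1 : forall u, N u -> rho (H u 1) = 0).
Hypothesis Hfix : forall u s, rho u = 0 -> 0 <= s <= 1 -> D (H u s) u = 0.

Hypothesis Yext : extensor b D [set u | rho u = 0].

Section fixed_problem.
Variables (Z : Type) (d : Z -> Z -> R) (B : set Z) (g : Z -> S).
Hypotheses (dm : pmetric d) (dd : definite d) (Bc : mclosed d B).
Hypothesis gL : forall z z', B z -> B z' -> D (g z) (g z') <= d z z'.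
Variable t : Z -> R.
Hypotheses (tL : forall z z', t z <= d z z' + t z') (t01 : forall z, 0 <= t z <= 1).
Hypothesis tB : forall z, B z -> t z = rho (g z).
Variables (k : R) (x : Z -> S).
Hypothesis k01 : 0 < k <= 4^-1.
Hypothesis xB : forall z, B z -> x z = g z.
Hypothesis xuc : forall e, 0 < e -> exists2 del, 0 < del & forall z z',
  collar d B t k z -> collar d B t k z' -> 0 < t z -> 0 < t z' ->
  d z z' < del * t z -> d z z' < del * t z' -> D (x z) (x z') < e.

Local Notation sB := (sdist d B).
Local Notation V := (collar d B t k).

Let d0 z z' : 0 <= d z z'. Proof. exact: pm_ge0. Qed.

Let BV z : B z -> V z.
Proof.
move=> Bz; rewrite /collar /= sdist_in // mulr_ge0 ?sqr_ge0 //.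
by case/andP: k01 => /ltW.
Qed.

(** A point of the collar with small [t] is joined to [B] by a step that is small
    in proportion to [t], the scale at which [x] is controlled. *)
Lemma collar_near e : 0 < e -> exists2 tau, 0 < tau & forall z, V z -> t z < tau ->
  exists y, [/\ B y, d z y <= t z & D (x z) (g y) < e].
Proof.
move=> e0; have [del del0 hdel] := xuc e0; exists del => // z Vz tdel.
have /andP[t0 t1] := t01 z; have s0 := sdist_ge0 dm B z.
case/andP: k01 => k0 k4.
case: (ltP 0 (t z)) => [tz|tz]; last first.
  have tz0 : t z = 0 by lra.
  have Bz : B z.
    by apply: (sdist_eq0 Bc); move: Vz; rewrite /collar /= tz0 expr0n mulr0; lra.
  by exists z; split => //; [rewrite (pm_xx dm)|rewrite xB // (pm_xx Dm)].
have [y [By zy ty]] := collar_base tL t01 k01 Vz tz.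
have kT : k * t z ^+ 2 <= 4^-1 * t z ^+ 2 by rewrite ler_wpM2r // sqr_ge0.
have zy' : d z y < t z * t z / 2 by move: kT zy; rewrite expr2; lra.
have tt0 : 0 < t z * t z by rewrite mulr_gt0.
have zy2 : d z y < t z / 2.
  by apply: lt_le_trans zy' _; rewrite ler_pM2r ?invr_gt0 ?ltr0n // ler_piMr.
have dT : t z * t z < t z * del by rewrite ltr_pM2l.
have dT2 : t z / 2 * del < t y * del by rewrite ltr_pM2r.
exists y; split => //; first lra.
by rewrite -(xB By); apply: hdel => //; [exact: BV|lra|lra|lra].
Qed.

(** Where [t] is bounded below, the relative control of [x] is an absolute one;
    where [t] is small, [x] is close to [g] at nearby points of [B]. *)
Lemma collar_uc : uc_on d D V x.
Proof.
move=> e e0; have e4 : 0 < e / 4 by rewrite divr_gt0.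
have [tau tau0 htau] := collar_near e4; have [del del0 hdel] := xuc e4.
pose m := Num.min tau (e / 8).
have m0 : 0 < m by rewrite lt_min tau0 divr_gt0.
have m1 : m <= tau by rewrite ge_min lexx.
have m2 : m <= e / 8 by rewrite ge_min lexx orbT.
have m4 : 0 < m / 4 by rewrite divr_gt0.
exists (Num.min (m / 4) (del * (m / 4))) => [|z z' Vz Vz' zz'].
  by rewrite lt_min m4 mulr_gt0.
have {zz'} [z1 z2] : d z z' < m / 4 /\ d z z' < del * (m / 4).
  by apply/andP; rewrite -lt_min.
have tt1 := tL z z'; have := tL z' z; rewrite (pm_sym dm z' z) => tt2.
have [h|h] := ltP (t z) (m / 2); last first.
  have l1 : del * (m / 4) <= del * t z by rewrite ler_pM2l //; lra.
  have l2 : del * (m / 4) <= del * t z' by rewrite ler_pM2l //; lra.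
  by apply: (@lt_le_trans _ _ (e / 4)); [apply: hdel => //; lra|lra].
have [y [By zy xy]] := htau z Vz ltac:(lra).
have [y' [By' zy' xy']] := htau z' Vz' ltac:(lra).
have := pm_quad (g y) (g y') (x z) (x z') Dm.
have := gL By By'; have := pm_quad z z' y y' dm.
rewrite (pm_sym Dm (g y') (x z')) (pm_sym dm y z); lra.
Qed.

Let q z := sB z / (k * t z ^+ 2).
Local Notation sg := (collar_time d B t k).

Lemma collar_time01 z : 0 <= sg z <= 1.
Proof. by rewrite /collar_time -/(q z); case: clampP; lra. Qed.

Lemma collar_time_lt1 z : 0 < t z -> sg z < 1 -> V z.
Proof.
move=> tz s1; have : q z <= 1.
  by move: s1; rewrite /collar_time -/(q z); case: clampP; lra.
by rewrite /q /collar /= ler_pdivrMr ?mul1r // mulr_gt0 ?exprn_gt0 //; case/andP: k01.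
Qed.

Lemma collar_time0 z : 0 < t z -> sB z <= k * t z ^+ 2 / 2 -> sg z = 0.
Proof.
move=> tz s1; have : q z <= 2^-1.
  rewrite /q ler_pdivrMr; first lra.
  by rewrite mulr_gt0 ?exprn_gt0 //; case/andP: k01.
by rewrite /collar_time -/(q z); case: clampP; lra.
Qed.

Lemma collar_timeB z : B z -> sg z = 0.
Proof.
move=> Bz; rewrite /collar_time sdist_in // mul0r.
by case: clampP; lra.
Qed.

Lemma collar_time_uc c e : 0 < c -> 0 < e -> exists2 del, 0 < del &
  forall z z', c <= t z -> c <= t z' -> d z z' < del -> `|sg z - sg z'| < e.
Proof.
move=> c0 e0; case/andP: k01 => k0 k4.
pose m := k * c ^+ 2; have m0 : 0 < m by rewrite mulr_gt0 // exprn_gt0.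
exists (e * m ^+ 2 / 5) => [|z z' cz cz' zz'].
  by rewrite divr_gt0 // mulr_gt0 // exprn_gt0.
pose w := k * t z ^+ 2; pose w' := k * t z' ^+ 2.
have /andP[t0 t1] := t01 z; have /andP[t0' t1'] := t01 z'.
have mw : m <= w by rewrite ler_pM2l // ler_pXn2r // nnegrE ltW.
have mw' : m <= w' by rewrite ler_pM2l // ler_pXn2r // nnegrE ltW.
have w1 : w <= 1 by rewrite /w; nra.
have w1' : w' <= 1 by rewrite /w'; nra.
have tt1 := tL z z'; have := tL z' z; rewrite (pm_sym dm z' z) => tt2.
have ss1 := sdist_lip dm B z z'; have := sdist_lip dm B z' z.
rewrite (pm_sym dm z' z) => ss2.
have := d0 z z' => dz0.
have ww : `|w' - w| <= d z z'.
  have -> : w' - w = k * (t z' + t z) * (t z' - t z) by rewrite /w /w'; ring.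
  have tts : `|t z' - t z| <= d z z' by rewrite ler_norml; lra.
  rewrite normrM; apply: le_trans (_ : 1 * d z z' <= _); last lra.
  by apply: ler_pM => //; rewrite ger0_norm; nra.
have ss : `|sB z - sB z'| <= d z z' by rewrite ler_norml; lra.
have s0 := sdist_ge0 dm B z'; have s1 := sdist_le1 dm B z'.
have qq : `|q z - q z'| <= 2 * d z z' / m ^+ 2.
  have w0 : 0 < w by lra.
  have w0' : 0 < w' by lra.
  have -> : q z - q z' = ((sB z - sB z') * w' + sB z' * (w' - w)) / (w * w').
    by rewrite /q -/w -/w'; field; rewrite !gt_eqF.
  rewrite normrM normfV; apply: ler_pM; first exact: normr_ge0.
  - by rewrite invr_ge0 normr_ge0.
  - apply: le_trans (ler_normD _ _) _.
    rewrite (normrM _ w') (normrM (sB z')).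
    rewrite (ger0_norm s0) (ger0_norm (ltW w0')).
    have : `|sB z - sB z'| * w' <= d z z' * 1 by apply: ler_pM => //; lra.
    have : sB z' * `|w' - w| <= 1 * d z z' by apply: ler_pM.
    lra.
  - have m20 : 0 < m ^+ 2 by rewrite exprn_gt0.
    have mww : m ^+ 2 <= `|w * w'|.
      rewrite gtr0_norm; last by rewrite mulr_gt0.
      by rewrite (expr2 m); apply: ler_pM => //; lra.
    by rewrite lef_pV2 // posrE; lra.
have qq2 : 2 * `|q z - q z'| < e.
  apply: (@le_lt_trans _ _ (4 * d z z' / m ^+ 2)); first lra.
  by rewrite ltr_pdivrMr ?exprn_gt0 //; lra.
have := clamp_lip (2 * q z - 1) (2 * q z' - 1).
have -> : 2 * q z - 1 - (2 * q z' - 1) = 2 * (q z - q z') by ring.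
by rewrite normrM (ger0_norm (ler0n _ 2)) => h; exact: le_lt_trans h qq2.
Qed.

Section collar_map.
Variables (U : set Z) (P : Z -> S).
Hypothesis UN : forall z, U z -> V z -> N (x z).
Hypothesis Puc : uc_on d D U P.
Hypothesis PH : forall z, U z -> V z -> D (P z) (H (x z) 1) = 0.

(** [P] takes over where the deformation has reached its end. *)
Definition collar_map (z : Z) : S :=
  if `[< V z >] then H (x z) (sg z) else P z.

Lemma collar_mapT z : V z -> collar_map z = H (x z) (sg z).
Proof. by move=> Vz; rewrite /collar_map asboolT. Qed.

Lemma collar_mapF z : ~ V z -> collar_map z = P z.
Proof. by move=> Vz; rewrite /collar_map asboolF. Qed.

(** Where [t] is small, [x z] is close to [Y0], whose points the deformation fixes:
    at every time the deformation stays close to its end. *)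
Lemma collar_map_near_Y0 e : 0 < e -> exists2 tau, 0 < tau &
  forall z, U z -> t z < tau -> D (collar_map z) (P z) < e.
Proof.
move=> e0; have e2 : 0 < e / 2 by rewrite divr_gt0.
have [c c0 cN] := Nrho.
have [del del0 hdel] := Huc e2.
pose m := Num.min del 1.
have m0 : 0 < m by rewrite lt_min del0 ltr01.
have mdel : m <= del by rewrite ge_min lexx.
have m1 : m <= 1 by rewrite ge_min lexx orbT.
have m2 : 0 < m / 2 by rewrite divr_gt0.
have [tau tau0 htau] := collar_near m2.
exists (Num.min tau (m / 4)) => [|z Uz]; first by rewrite lt_min tau0 divr_gt0.
rewrite lt_min => /andP[ztau zm].
have [Vz|Vz] := pselect (V z); last by rewrite collar_mapF // (pm_xx Dm).
have [y [By zy xy]] := htau z Vz ztau.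
have rg : rho (g y) < m / 2.
  by rewrite -(tB By); have := tL y z; rewrite (pm_sym dm y z); lra.
have [v Yv xv] : exists2 v, Y0 v & D (x z) v < m.
  by apply: sdist_lt => //; have := sdist_lip Dm Y0 (x z) (g y); lra.
have rv : rho v = 0 by exact: sdist_in.
have Nv : N v by apply: cN; rewrite rv.
have Nx := UN Uz Vz.
have xv' : D (x z) v < del by lra.
have s01 := collar_time01 z.
have h1 : D (H (x z) (sg z)) (H v (sg z)) < e / 2.
  by apply: hdel; rewrite ?subrr ?normr0.
have h2 : D (H (x z) 1) (H v 1) < e / 2.
  by apply: hdel; rewrite ?subrr ?normr0 ?lexx ?ler01.
have h3 := Hfix rv s01.
have h4 : D (H v 1) v = 0 by apply: Hfix; rewrite ?lexx ?ler01.
have h5 := PH Uz Vz.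
rewrite collar_mapT //.
have := pm_quad (H v (sg z)) (H v 1) (H (x z) (sg z)) (P z) Dm.
have := pm_tri Dm v (H v (sg z)) (H v 1).
have := pm_tri Dm (H (x z) 1) (H v 1) (P z).
rewrite (pm_sym Dm v (H v 1)) (pm_sym Dm (H v 1) (H (x z) 1)).
by rewrite (pm_sym Dm (H (x z) 1) (P z)); lra.
Qed.

Lemma collar_map_near_end e : 0 < e -> exists2 th, 0 < th &
  forall z, U z -> (V z -> 1 - th < sg z) -> D (collar_map z) (P z) < e.
Proof.
move=> e0; have [del del0 hdel] := Huc e0; exists del => // z Uz hz.
have [Vz|Vz] := pselect (V z); last by rewrite collar_mapF // (pm_xx Dm).
have s01 := collar_time01 z; have := hz Vz => s1.
have h1 : D (H (x z) (sg z)) (H (x z) 1) < e.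
  apply: hdel; rewrite ?lexx ?ler01 ?(pm_xx Dm) //; try exact: UN.
  by rewrite ltr_norml; lra.
rewrite collar_mapT //; have := PH Uz Vz.
have := pm_tri Dm (H (x z) 1) (H (x z) (sg z)) (P z).
by rewrite (pm_sym Dm (H (x z) 1) (P z)); lra.
Qed.

Lemma collar_map_uc : uc_on d D U collar_map.
Proof.
move=> e e0; have e3 : 0 < e / 3 by rewrite divr_gt0.
have [tau tau0 htau] := collar_map_near_Y0 e3.
have [th th0 hth] := collar_map_near_end e3.
have [dP dP0 hP] := Puc e3.
have [dH dH0 hH] := Huc e0.
have [dx dx0 hx] := collar_uc dH0.
have tau2 : 0 < tau / 2 by rewrite divr_gt0.
have [d2 d20 h2] := collar_time_uc tau2 th0.
have [d3 d30 h3] := collar_time_uc tau2 dH0.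
pose m := Num.min (Num.min dP dx) (Num.min (Num.min d2 d3) (tau / 2)).
have m0 : 0 < m by rewrite !lt_min dP0 dx0 d20 d30 tau2.
pose near z := D (collar_map z) (P z) < e / 3.
(* A point whose image is not close to that of [P] lies well inside the
   collar, and then so do the points near it. *)
have far z z' : U z -> U z' -> d z z' < m -> ~ near z ->
    D (collar_map z) (collar_map z') < e.
  rewrite !lt_min => Uz Uz' /andP[/andP[zP zx] /andP[/andP[z2 z3] zt]] nz.
  have tz : tau <= t z by rewrite leNgt; apply/negP => /(htau _ Uz).
  have [Vz sz] : V z /\ sg z <= 1 - th.
    have [Vz|Vz] := pselect (V z).
      split => //; rewrite leNgt; apply/negP => sz; apply: nz.
      by apply: hth.
    by exfalso; apply: nz; apply: hth.
  have tz' : tau / 2 <= t z' by have := tL z z'; lra.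
  have tz2 : tau / 2 <= t z by lra.
  have sz' : sg z' < 1.
    by have := h2 z z' tz2 tz' z2; rewrite ltr_norml; lra.
  have Vz' : V z' by apply: collar_time_lt1 => //; lra.
  rewrite !collar_mapT //; apply: hH; try exact: UN; try exact: collar_time01.
    exact: hx.
  exact: h3.
exists m => // z z' Uz Uz' zz'.
have [nz|nz] := pselect (near z); last exact: far.
have [nz'|nz'] := pselect (near z'); last first.
  by rewrite (pm_sym Dm); apply: far => //; rewrite (pm_sym dm).
have zP : d z z' < dP by move: zz'; rewrite !lt_min => /andP[/andP[]].
have := hP z z' Uz Uz' zP; have := pm_quad (P z) (P z') (collar_map z) (collar_map z') Dm.
by move: nz nz'; rewrite /near (pm_sym Dm (collar_map z') (P z')); lra.
Qed.

End collar_map.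

Lemma collar_closed c : mclosed d (V `&` [set z | t z <= c]).
Proof.
case/andP: k01 => k0 k4 z hz; split => /=; last first.
  apply/ler_addgt0Pr => e /hz[y [_ /= yc] zy].
  by have := tL z y; lra.
rewrite /collar /=; apply/ler_addgt0Pr => e e0.
have e2 : 0 < e / 2 by rewrite divr_gt0.
have [y [Vy _] zy] := hz _ e2.
have := tL y z; rewrite (pm_sym dm y z) => t1.
have := sdist_lip dm B z y => s1.
have /andP[tz0 tz1] := t01 z; have /andP[ty0 ty1] := t01 y.
have dz := d0 z y.
have tt : t y ^+ 2 <= t z ^+ 2 + 2 * d z y by nra.
have : k * t y ^+ 2 <= k * (t z ^+ 2 + 2 * d z y) by rewrite ler_wpM2l // ltW.
have : k * d z y <= 4^-1 * d z y by rewrite ler_wpM2r.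
move: Vy; rewrite /collar /=; lra.
Qed.

(** The deformation turns [x] near [Y0] into a map to [Y0], which extends further. *)
Lemma collar_extends : extends_to b d D setT B g.
Proof.
have [c1 [c10 c1N c1b]] : exists c1, [/\ 0 < c1,
    forall z, V z -> t z <= c1 -> N (x z) & b -> c1 = 1].
  have [bT|bF] := boolP b.
    (* In the absolute case nothing is cut off, as [t] is at most 1. *)
    by exists 1; split => // z _ _; rewrite (Nb bT).
  have [c c0 cN] := Nrho; have c2 : 0 < c / 2 by rewrite divr_gt0.
  have [tau tau0 htau] := collar_near c2.
  have m0 : 0 < Num.min tau (c / 2) by rewrite lt_min tau0 c2.
  exists (Num.min tau (c / 2) / 3); split => //; first by rewrite divr_gt0.
  move: m0; set m := Num.min _ _ => m0 z Vz tz.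
  have mtau : m <= tau by rewrite ge_min lexx.
  have mc : m <= c / 2 by rewrite ge_min lexx orbT.
  have [y [By zy xy]] := htau z Vz ltac:(lra).
  apply: cN; have := sdist_lip Dm Y0 (x z) (g y); rewrite -(tB By).
  by have := tL y z; rewrite (pm_sym dm y z); lra.
pose V1 := V `&` [set z | t z <= c1].
have gPuc : uc_on d D V1 (fun z => H (x z) 1).
  move=> e /Huc[del del0 hdel]; have [dx dx0 hx] := collar_uc del0.
  exists dx => // z z' [Vz tz] [Vz' tz'] zz'.
  by apply: hdel; rewrite ?subrr ?normr0 ?lexx ?ler01 //;
    [exact: c1N|exact: c1N|exact: hx].
have gPY z : V1 z -> rho (H (x z) 1) = 0 by move=> [Vz tz]; exact: H1 (c1N _ _ _).
have [P [e1 [e10 PV1 Puc _]]] :=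
  Yext.2 Z d V1 (fun z => H (x z) 1) dm dd (collar_closed (c := c1)) gPuc gPY.
have GB z : B z -> D (collar_map P z) (g z) = 0.
  by move=> Bz; rewrite collar_mapT ?collar_timeB ?H0 ?xB ?(pm_xx Dm) //; exact: BV.
have [bT|bF] := boolP b.
  exists (collar_map P), 1; split => //.
  have V1E z : V z -> V1 z by split => //=; rewrite c1b //; case/andP: (t01 z).
  have key : uc_on d D setT (collar_map P).
    apply: collar_map_uc => [z _ /V1E[Vz tz]|e /Puc[del del0 h]|z _ /V1E].
    - exact: c1N.
    - by exists del => // z z' _ _; apply: h; left.
    - exact: PV1.
  by move=> e /key[del del0 h]; exists del => // z z' _ _; exact: h.
case/andP: k01 => k0 k4.
pose c4 := c1 / 4; have c40 : 0 < c4 by rewrite divr_gt0.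
have c4E : c1 = 4 * c4 by rewrite /c4; field.
pose e0 := Num.min e1 (Num.min c4 (k * c4 ^+ 2 / 2)).
have e00 : 0 < e0 by rewrite !lt_min e10 c40 divr_gt0 // mulr_gt0 // exprn_gt0.
have e0e1 : e0 <= e1 by rewrite ge_min lexx.
have e0c4 : e0 <= c4 by rewrite !ge_min lexx !orbT.
have e0k : e0 <= k * c4 ^+ 2 / 2 by rewrite !ge_min lexx !orbT.
pose U0 : set Z := mnbhd false d B e0.
have U0E z : U0 z -> exists2 y, B y & d z y < e0 by case.
pose U := U0 `&` [set z | t z < c1 / 2].
have Guc : uc_on d D U (collar_map P).
  apply: collar_map_uc => [z [_ tz] Vz|e /Puc[del del0 h]|z [_ tz] Vz].
  - by apply: c1N => //; move: tz => /=; lra.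
  - have UV z : U z -> mnbhd b d V1 e1 z.
      move=> [/U0E[y By zy] /= tz]; right; exists y; last lra.
      split; first exact: BV.
      by move=> /=; have := tL y z; rewrite (pm_sym dm y z); lra.
    by exists del => // z z' /UV Uz /UV Uz'; exact: h.
  - by apply: PV1; split => //=; move: tz => /=; lra.
(* Away from [Y0] the neighbourhood lies in the part of the collar that does
   not move. *)
have still z : U0 z -> c4 <= t z -> V z /\ collar_map P z = x z.
  move=> /U0E[y By zy] cz.
  have := sdist_le dm z By => sz.
  have cc : k * c4 ^+ 2 <= k * t z ^+ 2.
    by rewrite ler_pM2l // ler_pXn2r // nnegrE ltW //; lra.
  have cc0 : 0 < k * c4 ^+ 2 by rewrite mulr_gt0 // exprn_gt0.
  have Vz : V z by rewrite /collar /=; lra.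
  split => //; rewrite collar_mapT // collar_time0 ?H0 //; lra.
exists (collar_map P), e0; split => // e e_gt0.
have [del del0 hdel] := Guc _ e_gt0.
have [dx dx0 hx] := collar_uc e_gt0.
exists (Num.min (Num.min del dx) (c4 / 2)) => [|z z' Uz Uz'].
  by rewrite !lt_min del0 dx0 divr_gt0.
rewrite !lt_min => /andP[/andP[zdel zdx] zc].
have tt1 := tL z z'; have := tL z' z; rewrite (pm_sym dm z' z) => tt2.
have [h|h] := ltP (t z) (c4 + c4 / 2).
  by apply: hdel => //; split => //=; lra.
have [Vz ->] := still z Uz ltac:(lra).
have [Vz' ->] := still z' Uz' ltac:(lra).
exact: hx.
Qed.

End fixed_problem.

Hypothesis Xext : relative_extensor D rho.

(** An extension property of the closed part [Y0], a relative one of its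
    complement and a deformation of a neighbourhood of [Y0] into [Y0] give an
    extension property of the whole space. *)
Theorem collar_extensor : extensor b D setT.
Proof.
apply: extensor_lipschitz => // [bT|Z d B g dm dd d1 Bc gL _].
  by have [a _] := Yext.1 bT; exists a.
have rho0 u := sdist_ge0 Dm Y0 u; have rho1 u := sdist_le1 Dm Y0 u.
have d0 z z' := pm_ge0 z z' dm.
pose h z y := rho (g y) + d z y.
have h0 z y : B y -> 0 <= h z y by move=> _; rewrite addr_ge0.
pose t z := cinf B (h z).
have t01 z : 0 <= t z <= 1 by rewrite (cinf_ge0 (h0 z)) (cinf_le1 (h0 z)).
have tL z z' : t z <= d z z' + t z'.
  rewrite -lerBlDl; apply: cinf_ge => [|y By].
    by have := t01 z; have := d0 z z'; lra.
  have : t z <= _ := cinf_le (h0 z) By.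
  by rewrite /h; have := pm_tri dm z' z y; lra.
have tB z : B z -> t z = rho (g z).
  move=> Bz; apply/eqP; rewrite eq_le; apply/andP; split.
    by have := cinf_le (h0 z) Bz; rewrite /h (pm_xx dm) addr0.
  apply: cinf_ge => // y By; rewrite /h.
  by have := sdist_lip Dm Y0 (g z) (g y); have := gL z y Bz By; lra.
have [k [x0 [k01 x0B x0uc]]] := Xext dm dd d1 Bc tL t01 gL tB.
pose x z := if `[< B z >] then g z else x0 z.
have xB z : B z -> x z = g z by move=> Bz; rewrite /x asboolT.
have xE z : 0 < t z -> x z = x0 z.
  by move=> tz; rewrite /x; case: asboolP => // Bz; rewrite x0B.
apply: (collar_extends dm dd Bc gL tL t01 tB k01 xB).
move=> e /x0uc[del del0 hdel]; exists del => // z z' Vz Vz' tz tz'.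
by rewrite !xE //; exact: hdel.
Qed.

End collar.
End Extension.

(** * Gluing two metric spaces *)

Section GluingMetric.
Variable R : realType.
Variables (X Y J : Type) (d : X -> X -> R) (dY : Y -> Y -> R).
Variables (j : J -> X) (f : J -> Y).

(** Distance to a point of [Y] through the glued part. *)
Definition glue_to (u : X + Y) (y : Y) : R :=
  match u with
  | inl x => cinf (fun=> True) (fun i => d x (j i) + dY (f i) y)
  | inr y0 => dY y0 y
  end.

Definition glue_sum (u v : X + Y) : R :=
  match u, v with
  | inl x, inl x' => d x x'
  | inr y, inr y' => dY y y'
  | _, _ => 1
  end.

(** As [f] does not increase distances, one passage through [Y] is enough. *)
Definition glue_dist (u v : X + Y) : R :=
  Num.min (glue_sum u v) (cinf (fun=> True) (fun y => glue_to u y + glue_to v y)).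

Hypotheses (dm : pmetric d) (dYm : pmetric dY).
Hypotheses (d1 : forall x x', d x x' <= 1) (dY1 : forall y y', dY y y' <= 1).
Hypothesis f1 : forall i i', dY (f i) (f i') <= d (j i) (j i').

Local Notation F := glue_to.
Local Notation D := glue_dist.

Let h0 x y i : True -> 0 <= d x (j i) + dY (f i) y.
Proof. by move=> _; rewrite addr_ge0 // pm_ge0. Qed.

Lemma glue_to_ge0 u y : 0 <= F u y.
Proof. by case: u => [x|y0] /=; [exact: cinf_ge0 (h0 x y)|exact: pm_ge0]. Qed.

Lemma glue_to_le1 u y : F u y <= 1.
Proof. by case: u => [x|y0] /=; [exact: cinf_le1 (h0 x y)|exact: dY1]. Qed.

Lemma glue_to_lt x y r : r <= 1 -> F (inl x) y < r ->
  exists i, d x (j i) + dY (f i) y < r.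
Proof. by move=> r1 /(cinf_lt r1)[i _ h]; exists i. Qed.

Lemma glue_to_tri u y y' : F u y <= F u y' + dY y' y.
Proof.
case: u => [x|y0]; last exact: pm_tri.
rewrite -lerBlDr; apply: cinf_ge => [|i _].
  by have := glue_to_le1 (inl x) y; have := pm_ge0 y' y dYm; lra.
have : F (inl x) y <= _ := cinf_le (h0 x y) (i := i) I.
by have := pm_tri dYm y' (f i) y; lra.
Qed.

(** A detour through [u] cannot shorten a distance in [Y]: this is where [f] has to
    be 1-Lipschitz. *)
Lemma glue_to_sep u y y' : dY y y' <= F u y + F u y'.
Proof.
case: u => [x|y0]; last first.
  by have := pm_tri dYm y0 y y'; rewrite (pm_sym dYm y y0).
rewrite leNgt; apply/negP => lt_sum.
have := glue_to_ge0 (inl x) y; have := glue_to_ge0 (inl x) y' => g' g.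
have := dY1 y y' => d1'.
pose gap := (dY y y' - F (inl x) y - F (inl x) y') / 2.
have gap0 : 0 < gap by rewrite divr_gt0 //; lra.
have gapE : gap + gap = dY y y' - F (inl x) y - F (inl x) y'.
  by rewrite /gap; lra.
have [i hi] : exists i, d x (j i) + dY (f i) y < F (inl x) y + gap.
  by apply: glue_to_lt; lra.
have [i' hi'] : exists i, d x (j i) + dY (f i) y' < F (inl x) y' + gap.
  by apply: glue_to_lt; lra.
have := f1 i i'; have := pm_tri dm x (j i) (j i').
have := pm_quad (f i) (f i') y y' dYm.
by rewrite (pm_sym dm (j i) x) (pm_sym dYm y (f i)); lra.
Qed.

Lemma glue_sum_ge0 u v : 0 <= glue_sum u v.
Proof. by case: u v => [x|y] [x'|y'] //=; exact: pm_ge0. Qed.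

Lemma glue_sum_le1 u v : glue_sum u v <= 1.
Proof. by case: u v => [x|y] [x'|y'] /=. Qed.

Lemma glue_sum_sym u v : glue_sum u v = glue_sum v u.
Proof. by case: u v => [x|y] [x'|y'] //=; exact: pm_sym. Qed.

Lemma glue_to_sum u v y : F u y <= glue_sum u v + F v y.
Proof.
have g0 := glue_to_ge0 v y; have g1 := glue_to_le1 u y.
case: u v g0 g1 => [x|y1] [x'|y2] g0 g1; 
    try by (rewrite [glue_sum _ _]/=; lra).
  rewrite -lerBlDl; apply: cinf_ge => [|i _].
    by rewrite /=; have := pm_ge0 x x' dm; lra.
  have : F (inl x) y <= _ := cinf_le (h0 x y) (i := i) I.
  by rewrite [glue_sum _ _]/=; have := pm_tri dm x' x (j i); lra.
exact: (pm_tri dYm y2 y1 y).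
Qed.

Let k0 u v y : True -> 0 <= F u y + F v y.
Proof. by move=> _; rewrite addr_ge0 // glue_to_ge0. Qed.

Lemma glue_dist_le_sum u v : D u v <= glue_sum u v.
Proof. by rewrite ge_min lexx. Qed.

Lemma glue_dist_le_to u v y : D u v <= F u y + F v y.
Proof. by rewrite ge_min (cinf_le (k0 u v) (i := y)) ?orbT. Qed.

Lemma glue_dist_ge u v r : r <= 1 -> r <= glue_sum u v ->
  (forall y, r <= F u y + F v y) -> r <= D u v.
Proof. by move=> r1 rs rF; rewrite le_min rs; apply: cinf_ge. Qed.

Lemma glue_dist_lt u v r : r <= 1 -> D u v < r ->
  glue_sum u v < r \/ exists y, F u y + F v y < r.
Proof.
rewrite gt_min => r1 /orP[h|/(cinf_lt r1)[y _ h]]; first by left.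
by right; exists y.
Qed.

Lemma glue_dist_le1 u v : D u v <= 1.
Proof. exact: le_trans (glue_dist_le_sum u v) (glue_sum_le1 u v). Qed.

Lemma glue_dist_pmetric : pmetric D.
Proof.
have Dge0 u v : 0 <= D u v.
  by apply: glue_dist_ge; [|exact: glue_sum_ge0|move=> y; exact: k0].
have Dsym u v : D u v = D v u.
  rewrite /D glue_sum_sym; congr Num.min; congr (cinf _ _).
  by apply/funext => y; rewrite addrC.
split=> // [u|v u w].
  apply/eqP; rewrite eq_le Dge0 andbT.
  apply: le_trans (glue_dist_le_sum u u) _.
  by case: u => [x|y] /=; rewrite pm_xx.
rewrite leNgt; apply/negP => lt_sum.
have := Dge0 u v; have := Dge0 v w; have := glue_dist_le1 u w => D1 D2 D3.
pose gap := (D u w - D u v - D v w) / 2.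
have gap0 : 0 < gap by rewrite divr_gt0 //; lra.
have gapE : gap + gap = D u w - D u v - D v w by rewrite /gap; lra.
have := @glue_dist_lt u v (D u v + gap) ltac:(lra) ltac:(lra).
have := @glue_dist_lt v w (D v w + gap) ltac:(lra) ltac:(lra).
move=> [h1|[y h1]] [h2|[y' h2]].
- suff : D u w <= glue_sum u v + glue_sum v w by lra.
  apply: le_trans (glue_dist_le_sum u w) _.
  have := glue_sum_le1 u w; have := glue_sum_ge0 u v; have := glue_sum_ge0 v w.
  case: u v w {D1 D2 D3 gap gap0 gapE lt_sum h1 h2} => [x|y1] [x'|y2] [x''|y3] /=;
    try lra; by move=> *; exact: pm_tri.
- have := glue_dist_le_to u w y'; have := glue_to_sum w v y'.
  by rewrite (glue_sum_sym w v); lra.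
- have := glue_dist_le_to u w y; have := glue_to_sum u v y; lra.
- have := glue_dist_le_to u w y'; have := glue_to_tri w y' y.
  by have := glue_to_sep v y y'; lra.
Qed.

Lemma glue_dist_inr u y : D u (inr y) = F u y.
Proof.
apply/eqP; rewrite eq_le; apply/andP; split.
  by have := glue_dist_le_to u (inr y) y; rewrite /= pm_xx // addr0.
apply: glue_dist_ge => [||y']; first exact: glue_to_le1.
  by case: u => [x|y0]; [exact: glue_to_le1|exact: lexx].
by have := glue_to_tri u y y'; rewrite /= (pm_sym dYm y y').
Qed.

Lemma glue_dist_inl x x' : D (inl x) (inl x') <= d x x'.
Proof. exact: glue_dist_le_sum. Qed.

Lemma glue_dist_glue i : D (inl (j i)) (inr (f i)) = 0.
Proof.
apply/eqP; rewrite eq_le (pm_ge0 _ _ glue_dist_pmetric) andbT glue_dist_inr.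
have := cinf_le (h0 (j i) (f i)) (i := i) I.
by rewrite (pm_xx dm) (pm_xx dYm) addr0.
Qed.

Local Notation rho := (sdist D (range inr)).

Lemma sdist_inr_le u y : rho u <= F u y.
Proof. by rewrite -glue_dist_inr; apply: (sdist_le glue_dist_pmetric); exists y. Qed.

(** Away from the glued part the gluing has not changed the metric. *)
Lemma glue_dist_far x x' :
  D (inl x) (inl x') < rho (inl x) -> d x x' <= D (inl x) (inl x').
Proof.
rewrite /D minElt; case: ifP => // _ /=.
have : rho (inl x) <= cinf (fun=> True) (fun y => F (inl x) y + F (inl x') y).
  apply: cinf_ge => [|y _]; first exact: sdist_le1 glue_dist_pmetric _ _.
  by have := sdist_inr_le (inl x) y; have := glue_to_ge0 (inl x') y; lra.
lra.
Qed.

Lemma sdist_inr_lt x r : r <= 1 -> rho (inl x) < r -> exists i, d x (j i) < r.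
Proof.
move=> r1 /(sdist_lt r1)[_ [y _ <-]]; rewrite glue_dist_inr => /(glue_to_lt r1).
by move=> [i hi]; exists i; have := pm_ge0 (f i) y dYm; lra.
Qed.

End GluingMetric.

(** * A metric relative to the distance to a set *)

Section RelativeMetric.
Variable R : realType.
Variables (Z : Type) (d : Z -> Z -> R) (t : Z -> R).
Hypotheses (dm : pmetric d) (tL : forall z z', t z <= d z z' + t z').
Hypothesis t0 : forall z, 0 < t z.

(** For 1-Lipschitz [t] this is a metric, the j-metric of a domain when [t] is the
    distance to its boundary.  Small balls are the balls whose radius is small in
    proportion to [t]. *)
Definition relative_dist (z z' : Z) : R := ln (1 + d z z' / Num.min (t z) (t z')).

Let m z z' := Num.min (t z) (t z').

Let m0 z z' : 0 < m z z'. Proof. by rewrite lt_min !t0. Qed.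

Let q0 z z' : 0 <= d z z' / m z z'.
Proof. by apply: divr_ge0; [exact: pm_ge0|exact: ltW]. Qed.

Let p0 z z' : 0 < 1 + d z z' / m z z'.
Proof. by have := q0 z z'; lra. Qed.

Lemma relative_dist_le z z' : relative_dist z z' <= d z z' / Num.min (t z) (t z').
Proof. by apply: le_ln1Dx; have := q0 z z'; rewrite /m; lra. Qed.

Lemma relative_dist_lt z z' e : 0 < e -> relative_dist z z' < ln (1 + e) ->
  d z z' < e * t z /\ d z z' < e * t z'.
Proof.
move=> e0; rewrite ltr_ln ?posrE; [|exact: p0|lra].
rewrite ltrD2l ltr_pdivrMr ?m0 // => h.
by split; apply: lt_le_trans h _; rewrite ler_pM2l // ge_min lexx ?orbT.
Qed.

Lemma relative_dist_definite : definite d -> definite relative_dist.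
Proof.
move=> dd z z'; rewrite -(ln1 R) => /ln_inj; rewrite !posrE => /(_ (p0 z z') ltr01).
move=> h; have : d z z' / m z z' = 0 by rewrite /m; lra.
move=> /eqP; rewrite mulf_eq0 invr_eq0 (gt_eqF (m0 z z')) orbF => /eqP.
exact: dd.
Qed.

Lemma relative_dist_pmetric : pmetric relative_dist.
Proof.
split=> [z|z z'|y x z].
- by rewrite /relative_dist (pm_xx dm) mul0r addr0 ln1.
- by rewrite /relative_dist minC (pm_sym dm).
rewrite /relative_dist -lnM ?posrE; [|exact: p0|exact: p0].
rewrite ler_ln ?posrE; [|exact: p0|by rewrite mulr_gt0 // p0].
wlog xz : x z / t x <= t z => [hw|].
  have [xz|zx] := orP (le_total (t x) (t z)); first exact: hw.
  have := hw z x zx; rewrite [leRHS]mulrC (pm_sym dm z x) (pm_sym dm z y) (pm_sym dm y x).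
  by rewrite (minC (t z) (t x)) (minC (t z) (t y)) (minC (t y) (t x)).
have dxy := pm_ge0 x y dm; have dyz := pm_ge0 y z dm.
have tri := pm_tri dm y x z.
have qxy := q0 x y; have qyz := q0 y z.
rewrite -/(m x y) -/(m y z) (min_l xz).
have [yx|xy] : t y < t x \/ t x <= t y.
    by apply/orP; rewrite ltNge orNb.
  have mxy : m x y = t y by apply: min_r; exact: ltW.
  have myz : m y z = t y by apply: min_l; lra.
  have h a : 0 <= a -> a / t x <= a / t y.
    by move=> a0; rewrite ler_wpM2l // lef_pV2 ?posrE // ltW.
  have h1 : d x z / t x <= d x z / t y by apply: h; exact: pm_ge0.
  have h2 : d x z / t y <= d x y / t y + d y z / t y.
    by rewrite -mulrDl ler_pM2r ?invr_gt0.
  have : 0 <= d x y / m x y * (d y z / m y z) by rewrite mulr_ge0.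
  by rewrite mxy myz; lra.
have mxy : m x y = t x by exact: min_l.
have myz : m y z <= t y by rewrite /m ge_min lexx.
have tyx : t y <= d x y + t x by rewrite -(pm_sym dm y x); exact: tL.
have h1 : d x z / t x <= d x y / t x + d y z / t x.
  by rewrite -mulrDl ler_pM2r ?invr_gt0.
have h2 : d y z / t x <= (1 + d x y / t x) * (d y z / m y z).
  have -> : 1 + d x y / t x = (t x + d x y) / t x by field; rewrite gt_eqF.
  rewrite mulrAC ler_pM2r ?invr_gt0 // mulrA ler_pdivlMr ?m0 // mulrC.
  by rewrite ler_wpM2r //; lra.
by rewrite mxy; lra.
Qed.

End RelativeMetric.

(** * Deforming a neighbourhood into a subspace *)

Section Deformation.
Variable R : realType.
Variables (X : Type) (d : X -> X -> R) (A : set X) (b : bool).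
Hypotheses (dm : pmetric d) (dd : definite d) (Ac : mclosed d A).

Lemma mclosedU Z (dZ : Z -> Z -> R) (B C : set Z) :
  mclosed dZ B -> mclosed dZ C -> mclosed dZ (B `|` C).
Proof.
move=> Bc Cc z hz; have [Bz|nBz] := pselect (B z); [by left|right].
have [e1 [e10 he1]] : exists e, 0 < e /\ forall y, B y -> ~ dZ z y < e.
  apply: contrapT => no; apply: nBz; apply: Bc => e e0.
  apply: contrapT => no'; apply: no; exists e; split => // y By zy.
  by apply: no'; exists y.
apply: Cc => e e0; have m0 : 0 < Num.min e e1 by rewrite lt_min e0.
have [y + zy] := hz _ m0; move: zy; rewrite lt_min => /andP[ze ze1] [By|Cy].
  by case: (he1 y By).
by exists y.
Qed.

(** Extending the identity of [A] gives a retraction [r] of a neighbourhood.  The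
    deformation is an extension to [X * R] of the map that is the projection on
    [X * {0}] and on [A * [0, 1]], and [r] on [N * {1}] for a smaller closed
    neighbourhood [N]. *)
Lemma deformation : extensor b d A -> extensor b d setT ->
  exists (N : set X) (h : X -> R -> X), [/\
    (b -> N = setT) /\ exists2 c, 0 < c & forall x, sdist d A x < c -> N x,
    forall e, 0 < e -> exists2 del, 0 < del & forall x x' s s',
      N x -> N x' -> 0 <= s <= 1 -> 0 <= s' <= 1 ->
      d x x' < del -> `|s - s'| < del -> d (h x s) (h x' s') < e,
    forall x, h x 0 = x, forall x, N x -> A (h x 1) &
    forall x s, A x -> 0 <= s <= 1 -> h x s = x].
Proof.
move=> [_ Aext] [_ Xext].
have [r [e0 [e00 rA ruc rU]]] : extends_to b d d A A id.
  by apply: Aext => // e e0; exists e.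
have {}rA x : A x -> r x = x by move=> Ax; apply: dd; exact: rA.
pose m := Num.min e0 1.
have m0 : 0 < m by rewrite lt_min e00 ltr01.
have me0 : m <= e0 by rewrite ge_min lexx.
have m1 : m <= 1 by rewrite ge_min lexx orbT.
pose N1 : set X := [set x | b \/ sdist d A x <= m / 2].
have N1U x : N1 x -> mnbhd b d A e0 x.
  move=> [bT|xm]; [by left|right].
  have [y Ay xy] : exists2 y, A y & d x y < m by apply: sdist_lt => //; lra.
  by exists y => //; lra.
have AU x : A x -> mnbhd b d A e0 x.
  by move=> Ax; right; exists x; rewrite ?(pm_xx dm).
pose dZ (p q : X * R) := d p.1 q.1 + `|p.2 - q.2|.
have dZm : pmetric dZ.
  split=> [p|p q|q p w]; rewrite /dZ.
  - by rewrite (pm_xx dm) subrr normr0 addr0.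
  - by rewrite (pm_sym dm) distrC.
  - have := pm_tri dm q.1 p.1 w.1; have := ler_distD q.2 p.2 w.2; lra.
have dZd : definite dZ.
  move=> [x s] [x' s']; rewrite /dZ /= => h.
  have := pm_ge0 x x' dm; have := normr_ge0 (s - s') => h1 h2.
  have -> : x = x' by apply: dd; lra.
  have /eqP : `|s - s'| = 0 by lra.
  by rewrite normr_eq0 subr_eq0 => /eqP ->.
have dZ1 p q : d p.1 q.1 <= dZ p q by rewrite lerDl.
have dZ2 p q : `|p.2 - q.2| <= dZ p q by rewrite lerDr; exact: pm_ge0.
have eq_lim (s c : R) : (forall e, 0 < e -> `|s - c| < e) -> s = c.
  move=> h; apply/eqP; rewrite -subr_eq0 -normr_eq0 eq_le normr_ge0 andbT.
  by apply/ler_addgt0Pr => e /h; lra.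
pose B1 : set (X * R) := [set p | p.2 = 0].
pose B2 : set (X * R) := [set p | p.2 = 1 /\ N1 p.1].
pose B3 : set (X * R) := [set p | A p.1 /\ 0 <= p.2 <= 1].
pose B := B1 `|` B2 `|` B3.
have Bc : mclosed dZ B.
  apply: mclosedU; first apply: mclosedU.
  - move=> p hp; apply: eq_lim => e /hp[q /= q0 pq].
    by have := dZ2 p q; rewrite q0; lra.
  - move=> p hp; split.
      apply: eq_lim => e /hp[q [/= q0 _] pq].
      by have := dZ2 p q; rewrite q0; lra.
    have [bT|bF] := pselect (is_true b); [by left|right].
    apply/ler_addgt0Pr => e /hp[q [_ [//|/= qm]] pq].
    by have := sdist_lip dm A p.1 q.1; have := dZ1 p q; lra.
  - move=> p hp; split.
      apply: Ac => e /hp[q [/= Aq _] pq]; exists q.1 => //.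
      by have := dZ1 p q; lra.
    apply/andP; split; apply/ler_addgt0Pr => e /hp[q [_ /andP[q0 q1]] pq];
      have := dZ2 p q; rewrite ler_norml; lra.
pose g (p : X * R) := if p.2 == 1 then r p.1 else p.1.
have gr p : B p -> (p.2 = 1 \/ A p.1) -> g p = r p.1 /\ mnbhd b d A e0 p.1.
  move=> Bp; rewrite /g => -[p1|Ap]; last first.
    by split; [case: ifP => // _; rewrite rA|exact: AU].
  rewrite p1 eqxx; split => //; case: Bp => [[/= p0|[_ /N1U//]]|[/AU//]].
  by move: p1; rewrite p0 => /eqP; rewrite eq_sym oner_eq0.
have g0 p : B p -> ~ (p.2 = 1 \/ A p.1) -> g p = p.1 /\ p.2 = 0.
  move=> Bp np; rewrite /g; case: eqP => p1; first by case: np; left.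
  split => //; case: Bp => [[//|[p1' _]]|[Ap _]]; case: np; by [left|right].
(* If [g] is given by [r] at one of two points and by the projection at the other,
   then the points have distance at least 1 or one of them lies over [A], where
   [r] is the identity. *)
have guc : uc_on dZ d B g.
  move=> e e_gt0; have [del del0 hdel] := ruc e e_gt0.
  exists (Num.min (Num.min del e) 1) => [|p p' Bp Bp'].
    by rewrite !lt_min del0 e_gt0 ltr01.
  rewrite !lt_min => /andP[/andP[zdel ze] z1].
  have h1 := dZ1 p p'; have h2 := dZ2 p p'.
  have [rp|np] := pselect (p.2 = 1 \/ A p.1);
    have [rp'|np'] := pselect (p'.2 = 1 \/ A p'.1).
  - have [-> U1] := gr p Bp rp; have [-> U2] := gr p' Bp' rp'.
    by apply: hdel => //; lra.
  - have [-> p0'] := g0 p' Bp' np'; case: rp => [p1|Ap].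
      by move: h2; rewrite p1 p0' subr0 normr1; lra.
    by have [-> _] := gr p Bp (or_intror Ap); rewrite rA //; lra.
  - have [-> p0] := g0 p Bp np; case: rp' => [p1'|Ap'].
      by move: h2; rewrite p1' p0 sub0r normrN normr1; lra.
    by have [-> _] := gr p' Bp' (or_intror Ap'); rewrite rA //; lra.
  - have [-> _] := g0 p Bp np; have [-> _] := g0 p' Bp' np'; lra.
have [G [e1 [e10 GB Guc _]]] := Xext _ dZ B g dZm dZd Bc guc (fun _ _ => I).
have {}GB p : B p -> G p = g p by move=> Bp; apply: dd; exact: GB.
pose c := Num.min e1 (m / 2).
have c0 : 0 < c by rewrite lt_min e10 divr_gt0.
have ce1 : c <= e1 by rewrite ge_min lexx.
have cm : c <= m / 2 by rewrite ge_min lexx orbT.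
pose N : set X := [set x | b \/ sdist d A x < c].
exists N, (fun x s => G (x, s)); split.
- split; first by move=> bT; apply/seteqP; split => // x _; left.
  by exists c => // x xc; right.
- have NU x s : N x -> 0 <= s <= 1 -> mnbhd b dZ B e1 (x, s).
    move=> [bT|xc] s01; [by left|right].
    have [y Ay xy] : exists2 y, A y & d x y < c by apply: sdist_lt => //; lra.
    exists (y, s); first by right.
    by rewrite /dZ /= subrr normr0; lra.
  move=> e /Guc[del del0 hdel]; exists (del / 2) => [|x x' s s' Nx Nx' s01 s01' h1 h2].
    by rewrite divr_gt0.
  by apply: hdel; [exact: NU|exact: NU|rewrite /dZ /=; lra].
- move=> x; rewrite GB; last by left; left.
  by rewrite /g /= eq_sym oner_eq0.
- move=> x Nx; have N1x : N1 x.
    by case: Nx => [bT|xc]; [left|right; lra].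
  rewrite GB; last by left; right.
  by rewrite /g /= eqxx; apply: rU; exact: N1U.
- move=> x s Ax s01; rewrite GB; last by right.
  by rewrite /g /=; case: eqP => // _; exact: rA.
Qed.

End Deformation.

(** * Extending maps to glued spaces *)

Section GluedExtensor.
Variable R : realType.
Variables (X Y J : Type) (d : X -> X -> R) (dY : Y -> Y -> R).
Variables (j : J -> X) (f : J -> Y).
Hypotheses (dm : pmetric d) (dYm : pmetric dY) (dd : definite d).
Hypotheses (d1 : forall x x', d x x' <= 1) (dY1 : forall y y', dY y y' <= 1).
Hypothesis f1 : forall i i', dY (f i) (f i') <= d (j i) (j i').
Hypothesis Ac : mclosed d (range j).

Local Notation D := (glue_dist d dY j f).
Local Notation Y0 := (range (@inr X Y)).
Local Notation rho := (sdist D Y0).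

Let Dm : pmetric D. Proof. exact: glue_dist_pmetric. Qed.
Let rho_inr y : rho (inr y) = 0.
Proof. by apply: sdist_in => //; exists y. Qed.

(** Off [Y0], [g] is a map to [X] that is uniformly continuous for
    [relative_dist]: at a scale below [t z], the distance of [g z] from [Y0], the
    distances of [X] and of the glued space agree. *)
Lemma glue_relative_extensor : extensor false d setT -> relative_extensor D rho.
Proof.
move=> [_ Xext] Z dZ B t g dZm dZd dZ1 Bc tL t01 gL tB.
have [[x0 _]|noX] := pselect (exists x0 : X, True); last first.
  (* Then [t] vanishes on [B], hence on the collar. *)
  have k01 : 0 < (4^-1 : R) <= 4^-1 by rewrite lexx invr_gt0 ltr0n.
  exists 4^-1, g; split => // e e0; exists 1 => // z z' Vz _ tz _ _ _.
  have [y [By _ ty]] := collar_base tL t01 k01 Vz tz.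
  move: (tB y By); case: (g y) => [x|y']; first by case: noX; exists x.
  by rewrite rho_inr; lra.
pose Zo := {z | 0 < t z}.
pose dq (z z' : Zo) :=
  relative_dist (fun z z' : Zo => dZ (sval z) (sval z')) (fun z => t (sval z)) z z'.
have dom : pmetric (fun z z' : Zo => dZ (sval z) (sval z')).
  by split=> *; [exact: pm_xx|exact: pm_sym|exact: pm_tri].
have tLo (z z' : Zo) : t (sval z) <= dZ (sval z) (sval z') + t (sval z').
  exact: tL.
have t0o (z : Zo) : 0 < t (sval z) := svalP z.
have dqm : pmetric dq := relative_dist_pmetric dom tLo t0o.
have dqd : definite dq.
  by apply: relative_dist_definite => // -[z zp] [z' zp'] /dZd/= ?; exact: eq_exist.
have dq_lt (z z' : Zo) e : 0 < e -> dq z z' < ln (1 + e) ->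
    dZ (sval z) (sval z') < e * t (sval z) /\ dZ (sval z) (sval z') < e * t (sval z').
  exact: relative_dist_lt.
have dq_gt (z z' : Zo) e : dZ (sval z) (sval z') < e * t (sval z) ->
    dZ (sval z) (sval z') < e * t (sval z') -> dq z z' < e.
  move=> h1 h2; apply: le_lt_trans (relative_dist_le dom t0o z z') _.
  rewrite ltr_pdivrMr ?lt_min ?t0o //.
  by case: (leP (t (sval z)) (t (sval z'))).
have lne e : 0 < e -> 0 < ln (1 + e) :> R.
  by move=> e0; rewrite -(ln1 R) ltr_ln ?posrE //; lra.
pose Bo : set Zo := [set z | B (sval z)].
pose go (z : Zo) := match g (sval z) with inl x => x | inr _ => x0 end.
have goE z : Bo z -> g (sval z) = inl (go z).
  move=> Bz; have := tB _ Bz; rewrite /go; case: (g (sval z)) => // y.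
  by rewrite rho_inr => tz; exfalso; have := t0o z; lra.
have Boc : mclosed dq Bo.
  move=> z hz; apply: Bc => e e0; have [y By zy] := hz _ (lne _ e0).
  exists (sval y) => //; have [h1 h2] := dq_lt _ _ _ e0 zy.
  apply: lt_le_trans h1 _; have := t01 (sval z); have := t0o z => z0 /andP[_ z1].
  by rewrite ler_piMr // ltW.
have gouc : uc_on dq d Bo go.
  move=> e e0; have m0 : 0 < Num.min e 1 by rewrite lt_min e0 ltr01.
  exists (ln (1 + Num.min e 1)) => [|z z' Bz Bz' /(dq_lt _ _ _ m0)[h1 _]].
    exact: lne.
  have t1 := t01 (sval z); have tz := t0o z.
  have {}h1 : dZ (sval z) (sval z') < e /\ dZ (sval z) (sval z') < t (sval z).
    split; apply: lt_le_trans h1 _.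
      apply: le_trans (_ : e * t (sval z) <= _); last by rewrite ler_piMr //; lra.
      by rewrite ler_wpM2r ?ge_min ?lexx // ltW.
    by rewrite -[leRHS]mul1r ler_wpM2r ?ge_min ?lexx ?orbT // ltW.
  case: h1 => he ht; have := gL _ _ Bz Bz'; rewrite !goE // => Dz.
  have : d (go z) (go z') <= D (inl (go z)) (inl (go z')).
    have rz : rho (inl (go z)) = t (sval z) by rewrite -goE // tB.
    by apply: glue_dist_far => //; rewrite rz; lra.
  lra.
have [G [e0 [e00 GB Guc _]]] := Xext Zo dq Bo go dqm dqd Boc gouc (fun _ _ => I).
pose k := Num.min 4^-1 (e0 / 8).
have k0 : 0 < k by rewrite lt_min invr_gt0 ltr0n divr_gt0.
have k4 : k <= 4^-1 by rewrite ge_min lexx.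
have k8 : k <= e0 / 8 by rewrite ge_min lexx orbT.
have k01 : 0 < k <= 4^-1 by rewrite k0.
pose x z := match pselect (0 < t z) with
            | left tz => inl (G (exist _ z tz))
            | right _ => g z
            end.
have xE z (tz : 0 < t z) : x z = inl (G (exist _ z tz)).
  by rewrite /x; case: pselect => // tz'; rewrite (Prop_irrelevance tz tz').
have Gnbhd (z : Zo) : collar dZ B t k (sval z) -> mnbhd false dq Bo e0 z.
  move=> Vz; right; have [y [By zy ty]] := collar_base tL t01 k01 Vz (t0o z).
  have ty0 : 0 < t y by have := t0o z; lra.
  exists (exist _ y ty0) => //=.
  have tz := t0o z; have /andP[_ t1] := t01 (sval z).
  have kt : k * t (sval z) ^+ 2 <= e0 / 8 * t (sval z).
    apply: ler_pM; [exact: ltW|exact: sqr_ge0|exact: k8|].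
    by rewrite expr2 ler_piMr // ltW.
  have et : e0 * (t (sval z) / 2) < e0 * t y by rewrite ltr_pM2l.
  have et0 : 0 < e0 * t (sval z) by rewrite mulr_gt0.
  by apply: dq_gt => /=; lra.
exists k, x; split => // [z Bz tz|e /Guc[del del0 hdel]].
  rewrite xE; have := goE (exist _ z tz) Bz; rewrite /= => ->.
  by congr inl; apply: dd; exact: GB.
exists del => // z z' Vz Vz' tz tz' h1 h2.
rewrite !xE; apply: le_lt_trans (glue_dist_inl _ _ _ _ _ _) _.
by apply: hdel; [exact: Gnbhd|exact: Gnbhd|exact: dq_gt].
Qed.

Lemma sdist_inr_eq0 u : rho u = 0 -> exists y, D u (inr y) = 0.
Proof.
case: u => [x|y] u0; last by exists y; exact: pm_xx.
have [i _ <-] : range j x.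
  apply: Ac => e e0; have m0 : 0 < Num.min e 1 by rewrite lt_min e0 ltr01.
  have [i hi] : exists i, d x (j i) < Num.min e 1.
    by apply: (sdist_inr_lt (f := f) dm dYm) => //; [rewrite ge_min lexx orbT|rewrite u0].
  by exists (j i) => //; apply: lt_le_trans hi _; rewrite ge_min lexx.
by exists (f i); exact: glue_dist_glue.
Qed.

(** Up to distance 0, the points at distance 0 from [Y0] are those of [Y]. *)
Lemma glue_base_extensor b :
  extensor b dY setT -> extensor b D [set u | rho u = 0].
Proof.
move=> [Yn Yext]; split => [bT|Z dZ B g dZm dZd Bc guc gB].
  by have [y _] := Yn bT; exists (inr y); exact: rho_inr.
have onY u : rho u = 0 -> exists y, D u (inr y) = 0 by exact: sdist_inr_eq0.
have [[y0 _]|noY] := pselect (exists y0 : Y, True); last first.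
  have nB z : ~ B z by move=> /gB/onY[y _]; apply: noY; exists y.
  have bF : b = false by apply/negbTE/negP => /Yn[y _]; apply: noY; exists y.
  have nU z : ~ mnbhd b dZ B 1 z by rewrite bF => -[//|[y /nB]].
  exists g, 1; split => // [z /nB//|e e0|z /nU//].
  by exists 1 => // z z' /nU.
pose gY z := match pselect (exists y, D (g z) (inr y) = 0) with
             | left h => projT1 (cid h)
             | right _ => y0
             end.
have gYE z : B z -> D (g z) (inr (gY z)) = 0.
  move=> /gB/onY h; rewrite /gY; case: pselect => [h'|/(_ h)//].
  exact: (projT2 (cid h')).
have inrD y y' : D (inr y) (inr y') = dY y y' by rewrite glue_dist_inr.
have gYuc : uc_on dZ dY B gY.
  move=> e /guc[del del0 hdel]; exists del => // z z' Bz Bz' /(hdel _ _ Bz Bz').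
  rewrite -inrD; have := pm_quad (g z) (g z') (inr (gY z)) (inr (gY z')) Dm.
  by rewrite (pm_sym Dm (inr _) (g z)) !gYE //; lra.
have [G [e0 [e00 GB Guc _]]] := Yext Z dZ B gY dZm dZd Bc gYuc (fun _ _ => I).
exists (fun z => inr (G z)), e0; split => //.
- move=> z Bz; have := pm_tri Dm (inr (gY z)) (inr (G z)) (g z).
  rewrite inrD GB // (pm_sym Dm (inr (gY z)) (g z)) gYE //.
  by have := pm_ge0 (inr (G z)) (g z) Dm; lra.
- move=> e /Guc[del del0 hdel]; exists del => // z z' Uz Uz' zz'.
  by rewrite inrD; exact: hdel.
- by move=> z _; exact: rho_inr.
Qed.

(** The deformation of [X] near the glued part is extended by the identity of [Y].
    It is uniformly continuous for the glued metric: far from [Y0] the metrics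
    agree, and near [Y0] the points hardly move. *)
Theorem glue_extensor b : extensor b d setT -> extensor b d (range j) ->
  extensor b dY setT -> extensor b D setT.
Proof.
move=> Xext Aext Yext.
have D1 u v : D u v <= 1 by exact: glue_dist_le1.
have Dinl x x' : D (inl x) (inl x') <= d x x' by exact: glue_dist_inl.
have rhoA x r : r <= 1 -> rho (inl x) < r -> exists2 a, range j a & d x a < r.
  move=> r1 xr; have [i hi] : exists i, d x (j i) < r.
    exact: (sdist_inr_lt (f := f) dm dYm).
  by exists (j i).
have Arho x : range j x -> rho (inl x) = 0.
  move=> [i _ <-]; have := sdist_lip Dm Y0 (inl (j i)) (inr (f i)).
  rewrite rho_inr glue_dist_glue //.
  by have := sdist_ge0 Dm Y0 (inl (j i)); lra.
have rhoA0 x : rho (inl x) = 0 -> range j x.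
  move=> x0; apply: Ac => e e0; have m0 : 0 < Num.min e 1 by rewrite lt_min e0 ltr01.
  have [||a Aa xa] := rhoA x (Num.min e 1).
  - by rewrite ge_min lexx orbT.
  - by rewrite x0.
  by exists a => //; apply: lt_le_trans xa _; rewrite ge_min lexx.
have [N [h [[Nb [c0 c00 Nc]] huc h0 h1 hA]]] := deformation dm dd Ac Aext Xext.
pose NS : set (X + Y) := [set u | if u is inl x then N x else True].
pose H (u : X + Y) s := if u is inl x then inl (h x s) else u.
pose c := Num.min c0 1.
have c_gt0 : 0 < c by rewrite lt_min c00 ltr01.
have cc0 : c <= c0 by rewrite ge_min lexx.
have c1 : c <= 1 by rewrite ge_min lexx orbT.
have NA x : range j x -> N x by move=> Ax; apply: Nc; rewrite sdist_in.
have near_id e : 0 < e -> exists2 del, 0 < del & forall u s, NS u ->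
    0 <= s <= 1 -> rho u < del -> D (H u s) u < e.
  move=> e_gt0; have e2 : 0 < e / 2 by rewrite divr_gt0.
  have [del del0 hdel] := huc _ e2.
  exists (Num.min (Num.min del 1) (e / 2)) => [|[x|y] s Nx s01 xr].
  - by rewrite !lt_min del0 ltr01 e2.
  - have [|a Aa] := rhoA x _ _ xr; first by rewrite !ge_min lexx orbT.
    rewrite !lt_min => /andP[/andP[xdel _] xe].
    have hx : d (h x s) (h a s) < e / 2.
      by apply: hdel; rewrite ?subrr ?normr0 //; exact: NA.
    apply: le_lt_trans (Dinl _ _) _.
    have := pm_tri dm a (h x s) x; rewrite -{1}(hA a s Aa s01) (pm_sym dm a x); lra.
  - by rewrite /H (pm_xx Dm).
apply: (@collar_extensor R _ D Y0 b NS H) => //.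
- by move=> bT; apply/seteqP; split => // -[x|y] // _; rewrite /NS /= Nb.
- exists c => // -[x|y] // xc; apply: Nc.
  have [a Aa xa] := rhoA x c c1 xc.
  by have := sdist_le dm x Aa; lra.
- move=> e e0; have e4 : 0 < e / 4 by rewrite divr_gt0.
  have [d2 d20 hd2] := near_id _ e4; have [d3 d30 hd3] := huc _ e0.
  pose m := Num.min (Num.min (d2 / 2) d3) (e / 4).
  have m0 : 0 < m by rewrite !lt_min d30 e4 divr_gt0.
  exists m => // u v s s' Nu Nv s01 s01'.
  rewrite !lt_min => /andP[/andP[uv2 uv3] uve] /andP[/andP[_ ss3] _].
  have luv := sdist_lip Dm Y0 u v; have := sdist_lip Dm Y0 v u.
  rewrite (pm_sym Dm v u) => lvu.
  have [ru|ru] := ltP (rho u) (d2 / 2).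
    have hu := hd2 u s Nu s01 ltac:(lra).
    have hv := hd2 v s' Nv s01' ltac:(lra).
    have := pm_quad u v (H u s) (H v s') Dm.
    by rewrite (pm_sym Dm v (H v s')); lra.
  case: u v Nu Nv uv2 uv3 uve ru luv lvu => [x|y] [x'|y'] Nu Nv uv2 uv3 uve ru luv lvu.
  + apply: le_lt_trans (Dinl _ _) _; apply: hd3 => //.
    have : d x x' <= D (inl x) (inl x') by apply: glue_dist_far => //; lra.
    lra.
  + by move: luv; rewrite rho_inr; lra.
  + by move: ru; rewrite rho_inr; lra.
  + by move: ru; rewrite rho_inr; lra.
- by move=> [x|y] //=; rewrite h0.
- by move=> [x|y] /= Nx; [apply: Arho; exact: h1|exact: rho_inr].
- move=> [x|y] s u0 s01; last by rewrite /H (pm_xx Dm).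
  by rewrite /H hA ?(pm_xx Dm) //; exact: rhoA0.
- exact: glue_base_extensor.
- by apply: glue_relative_extensor => //; exact: extensor_weaken Xext.
Qed.

End GluedExtensor.

(** * Metrics and uniform structures *)

Section UniformMetrics.
Variable R : realType.

Definition metrizes (T : uniformType) (d : T -> T -> R) : Prop :=
  forall E : set (T * T), entourage E <->
    exists2 e, 0 < e & forall x y, d x y < e -> E (x, y).

Lemma compatible_metricP (T : uniformType) (d : T -> T -> R) :
  compatible_metric d <-> [/\ pmetric d, definite d & metrizes d].
Proof.
split=> [[d0 ds dt de]|[dm dd de]].
  split=> [||E].
  - by split=> [x|x y|y x z]; [exact/d0|exact: ds|exact: dt].
  - by move=> x y /d0.
  - rewrite de /entourage_; split => [[e /= e0 h]|[e e0 h]].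
      by exists e => // x y xy; exact: (h (x, y)).
    by exists e => //= -[x y] /= xy; exact: h.
split.
- by move=> x y; split => [/dd|->]; last exact: (pm_xx dm).
- exact: (pm_sym dm).
- by move=> x y z; exact: (pm_tri dm).
apply/funext => E; apply/propext; split=> [/de[e e0 h]|[e /= e0 h]].
  by exists e => //= -[x y] /= xy; exact: h.
by apply/de; exists e => // x y xy; exact: (h (x, y)).
Qed.

Lemma metrizes_set_type (T : uniformType) (d : T -> T -> R) (B : set T) :
  metrizes d -> metrizes (fun u v : set_type B => d (set_val u) (set_val v)).
Proof.
move=> de E; split=> [[V /de[e e0 h] VE]|[e e0 h]].
  by exists e => // u v uv; apply: VE => /=; exact: h.
exists [set p | d p.1 p.2 < e]; first by apply/de; exists e.
by move=> [u v] /= uv; exact: h.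
Qed.

Lemma metrizes_uc (T V : uniformType) (dT : T -> T -> R) (dV : V -> V -> R)
    (g : T -> V) : metrizes dT -> metrizes dV ->
  unif_continuous g <-> uc_on dT dV setT g.
Proof.
move=> eT eV; split => [gc e e0|gc E /eV[e e0 h]].
  have /gc/eT[del del0 hdel] : entourage [set p : V * V | dV p.1 p.2 < e].
    by apply/eV; exists e.
  by exists del => // z z' _ _; exact: hdel.
have [del del0 hdel] := gc e e0; apply/eT; exists del => // x y xy.
by apply: h; exact: hdel.
Qed.

Lemma metrizes_closed (T : uniformType) (d : T -> T -> R) (B : set T) :
  metrizes d -> closed B <-> mclosed d B.
Proof.
move=> de; split=> [Bc z hz|Bc z hz].
  apply: Bc => V /nbhsP[E /de[e e0 h] EV].
  have [y By zy] := hz e e0; exists y; split => //.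
  by apply: EV; apply/mem_set; exact: h.
apply: Bc => e e0.
have /hz[y [By zy]] : nbhs z (xsection [set p : T * T | d p.1 p.2 < e] z).
  by apply: nbhs_entourage; apply/de; exists e.
by exists y => //; move/set_mem: zy.
Qed.

Lemma metrizes_equiv (T : uniformType) (d d' : T -> T -> R) :
  uc_on d d' setT id -> uc_on d' d setT id -> metrizes d -> metrizes d'.
Proof.
move=> h1 h2 de E; split=> [/de[e e0 h]|[e e0 h]].
  have [del del0 hdel] := h2 e e0; exists del => // x y xy.
  by apply: h; exact: hdel.
have [del del0 hdel] := h1 e e0; apply/de; exists del => // x y xy.
by apply: h; exact: hdel.
Qed.

(** The proof is a parameter of the type so that the uniform structure can be
    inferred from it. *)
Definition metric_space (T : Type) (d : T -> T -> R) (dm : pmetric d) : Type := T.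

Section metric_space.
Local Open Scope relation_scope.
Variables (T : Type) (d : T -> T -> R) (dm : pmetric d).
Local Notation S := (metric_space dm).

Definition metric_ent : set_system (S * S) :=
  [set E | exists2 e, 0 < e & forall x y, d x y < e -> E (x, y)].

Let metric_ent_filter : Filter metric_ent.
Proof.
split.
- by exists 1.
- move=> P Q [e e0 h] [e' e0' h']; exists (Num.min e e').
    by rewrite lt_min e0.
  by move=> x y; rewrite lt_min => /andP[/h Pxy /h' Qxy].
- by move=> P Q PQ [e e0 h]; exists e => // x y /h/PQ.
Qed.

Let metric_ent_diagonal E : metric_ent E -> diagonal `<=` E.
Proof. by move=> [e e0 h] [u v] /diagonalP ->; apply: h; rewrite (pm_xx dm). Qed.

Let metric_ent_inv E : metric_ent E -> metric_ent E^-1.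
Proof.
by move=> [e e0 h]; exists e => // x y xy; apply: h; rewrite (pm_sym dm).
Qed.

Let metric_ent_split E : metric_ent E -> exists2 B, metric_ent B & B \; B `<=` E.
Proof.
move=> [e e0 h]; exists [set p | d p.1 p.2 < e / 2].
  by exists (e / 2) => //; rewrite divr_gt0.
by move=> [x y] [z /= xz zy]; apply: h; have := pm_tri dm z x y; lra.
Qed.

HB.instance Definition _ := gen_eqMixin S.
HB.instance Definition _ := gen_choiceMixin S.
HB.instance Definition _ := isUniform.Build S
  metric_ent_filter metric_ent_diagonal metric_ent_inv metric_ent_split.

Lemma metric_space_metrizes : metrizes (d : S -> S -> R).
Proof. by []. Qed.

End metric_space.

End UniformMetrics.

(** * The adjunction space *)

Section AdjunctionMetric.
Local Open Scope quotient_scope.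
Variable R : realType.
Variables (X Y : uniformType) (A : set X) (f : set_type A -> Y).
Variables (d : X -> X -> R) (dY : Y -> Y -> R).
Hypotheses (dm : pmetric d) (dYm : pmetric dY).
Hypotheses (dd : definite d) (dYd : definite dY).
Hypotheses (d1 : forall x x', d x x' <= 1) (dY1 : forall y y', dY y y' <= 1).
Hypotheses (de : metrizes d) (dYe : metrizes dY).
Hypothesis f1 : forall a a', dY (f a) (f a') <= d (set_val a) (set_val a').
Hypothesis Ac : mclosed d A.

Local Notation W := (adjunction_space f).
Local Notation D := (glue_dist d dY (@set_val X A) f).

Definition adjunction_dist (u v : W) : R := D (repr u) (repr v).

Let Dm : pmetric D. Proof. exact: glue_dist_pmetric. Qed.

Lemma glue_equiv_dist u v : glue_equiv f u v -> D u v = 0.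
Proof.
move/asboolP; elim=> {u v} [u v [a [-> ->]]|u|u v _ uv|u v w _ uv _ vw].
- exact: glue_dist_glue.
- exact: pm_xx.
- by rewrite (pm_sym Dm).
- by have := pm_tri Dm v u w; have := pm_ge0 u w Dm; lra.
Qed.

(** If two different points of [X] have distance 0, then paths through [Y] of
    arbitrarily small length join them, so that they lie in the closed set [A]. *)
Lemma glue_dist_eq0 u v : D u v = 0 -> glue_equiv f u v.
Proof.
have inrE w y : D w (inr y) = glue_to d dY (@set_val X A) f w y.
  exact: glue_dist_inr.
have aD0 (a : set_type A) : D (inl (set_val a)) (inr (f a)) = 0.
  exact: glue_dist_glue.
have inA x y : D (inl x) (inr y) = 0 -> glue_equiv f (inl x) (inr y).
  move=> xy0; have xA : A x.
    apply: Ac => e e0; have m0 : 0 < Num.min e 1 by rewrite lt_min e0 ltr01.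
    have [i hi] : exists i : set_type A, d x (set_val i) + dY (f i) y < Num.min e 1.
      apply: glue_to_lt; first by rewrite ge_min lexx orbT.
      by rewrite -inrE xy0.
    exists (set_val i); first exact: set_valP.
    have := pm_ge0 (f i) y dYm; move: hi; rewrite lt_min => /andP[h _]; lra.
  pose a : set_type A := exist _ x (mem_set xA).
  apply/asboolP; apply: rst_step; exists a; split => //; congr inr.
  apply: dYd; have := pm_tri Dm (inl x) (inr (f a)) (inr y).
  have ax0 : D (inl x) (inr (f a)) = 0 := aD0 a.
  rewrite xy0 (pm_sym Dm _ (inl x)) ax0.
  by rewrite inrE /= (pm_sym dYm); have := pm_ge0 y (f a) dYm; lra.
have E1 w : glue_equiv f w w by apply/asboolP; exact: rst_refl.
have E2 w w' : glue_equiv f w w' -> glue_equiv f w' w.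
  by move=> /asboolP h; apply/asboolP; exact: rst_sym.
have E3 w' w w'' : glue_equiv f w w' -> glue_equiv f w' w'' -> glue_equiv f w w''.
  by move=> /asboolP h /asboolP h'; apply/asboolP; exact: rst_trans h h'.
case: u v => [x|y] [x'|y'] uv0.
- have [xx'|xx'] := pselect (d x x' = 0); first by rewrite (dd xx').
  have xx'0 : 0 < d x x' by rewrite lt_def pm_ge0 // andbT; exact/eqP.
  have xA : A x.
    apply: Ac => e e0; pose m := Num.min (Num.min e 1) (d x x').
    have m0 : 0 < m by rewrite !lt_min e0 ltr01.
    have m1 : m <= 1 by rewrite !ge_min lexx orbT.
    have me : m <= e by rewrite !ge_min lexx.
    have mx : m <= d x x' by rewrite !ge_min lexx orbT.
    have uvm : D (inl x) (inl x') < m by rewrite uv0.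
    have [/=|[y hy]] := glue_dist_lt m1 uvm; first lra.
    have F0 : 0 <= glue_to d dY (@set_val X A) f (inl x') y by exact: glue_to_ge0.
    have [i hi] : exists i : set_type A, d x (set_val i) + dY (f i) y < m.
      by apply: glue_to_lt => //; lra.
    exists (set_val i); first exact: set_valP.
    by have := pm_ge0 (f i) y dYm; lra.
  pose a : set_type A := exist _ x (mem_set xA).
  have xfa : D (inl x) (inr (f a)) = 0 := aD0 a.
  have x'fa : D (inl x') (inr (f a)) = 0.
    have := pm_tri Dm (inl x) (inl x') (inr (f a)).
    rewrite (pm_sym Dm (inl x') (inl x)) uv0 xfa.
    by have := pm_ge0 (inl x') (inr (f a)) Dm; lra.
  by apply: (E3 (inr (f a))); [exact: inA|apply: E2; exact: inA].
- exact: inA.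
- by apply: E2; apply: inA; rewrite (pm_sym Dm).
- by move: uv0; rewrite inrE /= => /dYd ->.
Qed.

Lemma pi_glue_equiv u v : glue_equiv f u v -> \pi_W u = \pi_W v.
Proof. by move=> uv; apply/eqmodP. Qed.

Lemma adjunction_dist_pi u v : adjunction_dist (\pi_W u) (\pi_W v) = D u v.
Proof.
have rE w : D (repr (\pi_W w)) w = 0.
  by apply: glue_equiv_dist; apply/eqmodP; exact: reprK.
exact: (pm_eq0 Dm).
Qed.

Lemma adjunction_dist_pmetric : pmetric adjunction_dist.
Proof.
by split=> *; [exact: (pm_xx Dm)|exact: (pm_sym Dm)|exact: (pm_tri Dm)].
Qed.

Lemma adjunction_dist_definite : definite adjunction_dist.
Proof.
move=> u v /glue_dist_eq0/pi_glue_equiv.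
by rewrite !reprK.
Qed.

(** Every pair of close points is joined by at most four steps, each of them between
    images of points that are close in [X] or in [Y]; a chain of entourages as
    in the quotient uniformity absorbs them.  The converse is the universal
    property of the quotient. *)
Lemma adjunction_dist_metrizes : metrizes adjunction_dist.
Proof.
move=> E; split=> [[S [<- S2 Se]]|[e e0 h]]; last first.
  have gc : unif_continuous (id : W -> metric_space adjunction_dist_pmetric).
    apply/uniform_quotient_continuous => E' [e' e0' h'].
    split; [apply/de|apply/dYe]; exists e' => // x y xy; apply: h';
      rewrite adjunction_dist_pi; apply: le_lt_trans xy.
      exact: glue_dist_inl.
    by rewrite (glue_dist_inr (@set_val X A) f dm dYm).
  have /gc gE : @entourage (metric_space adjunction_dist_pmetric) E by exists e.
  have {gE} : @entourage W [set p | E (p.1, p.2)] := gE.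
  by apply: filterS => -[].
have Srefl n w : S n (w, w).
  by have := entourage_refl (repr w) (Se n); rewrite /= reprK.
have Sincl n p : S n.+1 p -> S n p.
  by case: p => w w' h; apply: S2; exists w.
have [/de[eX eX0 hX] /dYe[eY eY0 hY]] := Se 3.
pose del := Num.min (Num.min eX eY) 1.
have del0 : 0 < del by rewrite !lt_min eX0 eY0 ltr01.
have del1 : del <= 1 by rewrite !ge_min lexx orbT.
have delX : del <= eX by rewrite !ge_min lexx.
have delY : del <= eY by rewrite !ge_min lexx orbT.
have SX x x' : d x x' < del -> S 3 (\pi_W (inl x), \pi_W (inl x')).
  by move=> xx'; apply: hX; lra.
have SY y y' : dY y y' < del -> S 3 (\pi_W (inr y), \pi_W (inr y')).
  by move=> yy'; apply: hY; lra.
have SF u y : glue_to d dY (@set_val X A) f u y < del ->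
    S 2 (\pi_W u, \pi_W (inr y)) /\ S 2 (\pi_W (inr y), \pi_W u).
  case: u => [x|y0] /= xy; last first.
    by split; apply: Sincl; apply: SY => //; rewrite (pm_sym dYm).
  have [i hi] := glue_to_lt del1 xy.
  have := pm_ge0 (f i) y dYm; have := pm_ge0 x (set_val i) dm => h1 h2.
  have gi : \pi_W (inl (set_val i)) = \pi_W (inr (f i)).
    by apply: pi_glue_equiv; apply/asboolP; apply: rst_step; exists i.
  split; apply: S2.
    by exists (\pi_W (inr (f i))); [rewrite -gi; apply: SX; lra|apply: SY; lra].
  exists (\pi_W (inr (f i))); first by apply: SY; rewrite (pm_sym dYm); lra.
  by rewrite -gi; apply: SX; rewrite (pm_sym dm); lra.
exists del => // w w' ww'; rewrite -[w]reprK -[w']reprK.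
have [|[y hy]] := glue_dist_lt del1 ww'.
  have S0 p : S 3 p -> S 0%N p by move=> ?; do 3 apply: (Sincl _ _ _).
  case: (repr w) (repr w') => [x|y] [x'|y'] /= h.
  - by apply: S0; exact: SX.
  - by move: del1; rewrite leNgt h.
  - by move: del1; rewrite leNgt h.
  - by apply: S0; exact: SY.
have F0 u : 0 <= glue_to d dY (@set_val X A) f u y by exact: glue_to_ge0.
have := F0 (repr w); have := F0 (repr w') => F0' F0''.
have [h1 _] := SF (repr w) y ltac:(lra).
have [_ h2] := SF (repr w') y ltac:(lra).
by apply: Sincl; apply: S2; exists (\pi_W (inr y)).
Qed.

End AdjunctionMetric.

(** * Absolute retracts and extensors *)

Section UniformRetracts.
Local Open Scope quotient_scope.
Variable R : realType.

Definition uniform_retract (b : bool) (Z : uniformType) (C : set Z) : Prop :=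
  if b then exists r : Z -> C, uniform_retraction r
  else exists2 U : set Z, uniform_nbhd R C U &
    exists r : U -> (set_val @^-1` C : set U), uniform_retraction r.

(** By conversion, [uniform_AR] for [b] true and [uniform_ANR] for [b] false. *)
Definition absolute_retract (b : bool) (Y : uniformType) : Prop :=
  metrizable_uniform R Y /\
  forall (Z : uniformType) (i : Y -> Z),
    metrizable_uniform R Z -> uniform_embedding i -> closed (range i) ->
    uniform_retract b (range i).

(** Retractions become extension problems, stated for one given metric whereas a
    uniform neighbourhood may refer to any compatible one. *)
Lemma uniform_retractP b (Z : uniformType) (d : Z -> Z -> R) (C : set Z) :
  pmetric d -> definite d -> metrizes d ->
  uniform_retract b C <-> extends_to b d d C C id.
Proof.
move=> dm dd de; have dC := metrizes_set_type (B := C) de.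
case: b; split.
- move=> [r [/(metrizes_uc _ de dC) ruc rC]].
  exists (fun z => set_val (r z)), 1; split => //.
  + move=> z Cz; have := rC (exist _ z (mem_set Cz)).
    by move=> /(congr1 set_val) /= ->; exact: pm_xx.
  + move=> e /ruc[del del0 h]; exists del => // z z' _ _ zz'; exact: h.
  + by move=> z _; exact: set_valP.
- move=> [G [e [e0 GC Guc GU]]].
  have GA z : C (G z) by apply: GU; left.
  exists (fun z => exist _ (G z) (mem_set (GA z)) : C); split.
    apply/(metrizes_uc _ de dC) => e' /Guc[del del0 h]; exists del => // z z' _ _ zz'.
    by apply: h => //; left.
  move=> [z Cz]; apply: val_inj => /=; apply: dd; apply: GC; exact: set_mem.
- move=> [U [d' [e [/compatible_metricP[dm' dd' de'] e0 hU]]] [r [ruc rC]]].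
  have dU := metrizes_set_type (B := U) de.
  have dUC := metrizes_set_type (B := (set_val @^-1` C : set U)) dU.
  move/(metrizes_uc _ dU dUC) : ruc => ruc.
  have [e1 e10 he1] : exists2 e1, 0 < e1 & forall x y, d x y < e1 -> d' x y < e.
    have : entourage [set p : Z * Z | d' p.1 p.2 < e] by apply/de'; exists e.
    by move=> /de[e1 e10 h]; exists e1 => // x y; exact: h.
  have nU z : mnbhd false d C e1 z -> U z.
    move=> [//|[y Cy zy]]; apply: (hU y) => //.
    by rewrite (pm_sym dm'); exact: he1.
  pose G z := match pselect (U z) with
              | left Uz => set_val (set_val (r (exist _ z (mem_set Uz))))
              | right _ => z
              end.
  have GE z (Uz : z \in U) : G z = set_val (set_val (r (exist _ z Uz))).
    rewrite /G; case: pselect => [Uz'|]; last by move=> /(_ (set_mem Uz)).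
    by rewrite (Prop_irrelevance (mem_set Uz') Uz).
  exists G, e1; split => //.
  + move=> z Cz; have Uz : z \in U.
      by apply/mem_set/nU; right; exists z => //; rewrite pm_xx.
    rewrite (GE z Uz); pose u : U := exist _ z Uz.
    have Cu : (set_val @^-1` C : set U) u by [].
    have := rC (exist _ u (mem_set Cu)) => /= rE.
    by rewrite -/u rE; exact: pm_xx.
  + move=> e' /ruc[del del0 h]; exists del => // z z' /nU/mem_set Uz /nU/mem_set Uz' zz'.
    by rewrite (GE z Uz) (GE z' Uz'); exact: h.
  + move=> z /nU/mem_set Uz; rewrite (GE z Uz).
    exact: (set_valP (r (exist _ z Uz))).
- move=> [G [e [e0 GC Guc GU]]].
  pose U : set Z := mnbhd false d C e.
  have dU := metrizes_set_type (B := U) de.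
  have dUC := metrizes_set_type (B := (set_val @^-1` C : set U)) dU.
  exists U.
    exists d, e; split => //; first by apply/compatible_metricP.
    by move=> y z Cy yz; right; exists y => //; rewrite (pm_sym dm).
  have CU z : C z -> U z by move=> Cz; right; exists z => //; rewrite pm_xx.
  have GA (u : U) : C (G (set_val u)) by apply: GU; exact: set_valP.
  pose r0 (u : U) : U := exist _ (G (set_val u)) (mem_set (CU _ (GA u))).
  have r0C u : (set_val @^-1` C : set U) (r0 u) by exact: GA.
  exists (fun u => exist _ (r0 u) (mem_set (r0C u))); split.
    apply/(metrizes_uc _ dU dUC) => e' /Guc[del del0 h]; exists del => // u u' _ _ uu'.
    by apply: h => //; exact: set_valP.
  move=> [[z Uz] Cz]; apply: val_inj; apply: val_inj => /=.
  by apply: dd; apply: GC; have := set_mem Cz.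
Qed.

Lemma bounded_metric (T : uniformType) : metrizable_uniform R T ->
  exists d : T -> T -> R, [/\ pmetric d, definite d, metrizes d &
    forall x y, d x y <= 1].
Proof.
move=> [d /compatible_metricP[dm dd de]].
have [||d' [[dm' dd'] d'1 h1 h2 _]] :=
  @remetrize R T False d (fun i => match i with end) (fun _ _ => 0) dm dd.
- by [].
- by move=> e e0; exists e.
by exists d'; split => //; exact: metrizes_equiv de.
Qed.

Lemma lipschitz_metrics (X Y : uniformType) (A : set X) (f : set_type A -> Y) :
  metrizable_uniform R X -> metrizable_uniform R Y -> unif_continuous f ->
  exists (d : X -> X -> R) (dY : Y -> Y -> R),
    [/\ [/\ pmetric d, definite d, metrizes d & forall x y, d x y <= 1],
        [/\ pmetric dY, definite dY, metrizes dY & forall x y, dY x y <= 1] &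
        forall a a', dY (f a) (f a') <= d (set_val a) (set_val a')].
Proof.
move=> [d /compatible_metricP[dm dd de]] /bounded_metric[dY [dYm dYd dYe dY1]] fc.
have [||d' [[dm' dd'] d'1 h1 h2 f1]] :=
  @remetrize R X (set_type A) d (@set_val X A) (fun a a' => dY (f a) (f a')) dm dd.
- by move=> a a'; exact: dY1.
- move/(metrizes_uc _ (metrizes_set_type (B := A) de) dYe) : fc => fc e.
  by move=> /fc[del del0 h]; exists del => // a a'; exact: h.
by exists d', dY; split => //; split => //; exact: metrizes_equiv de.
Qed.

(** A map to [Y] extends because [Y] is a retract of the space obtained by gluing
    along it. *)
Lemma absolute_retract_extends b (Y : uniformType) (dY : Y -> Y -> R)
    (Z : Type) (d : Z -> Z -> R) (B : set Z) (f : set_type B -> Y) :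
  absolute_retract b Y -> pmetric dY -> definite dY -> metrizes dY ->
  (forall y y', dY y y' <= 1) ->
  pmetric d -> definite d -> (forall z z', d z z' <= 1) -> mclosed d B ->
  (forall u u', dY (f u) (f u') <= d (set_val u) (set_val u')) ->
  exists2 e, 0 < e & exists F : set_type (mnbhd b d B e) -> Y,
    (forall u v, set_val u = set_val v -> F u = f v) /\
    forall e', 0 < e' -> exists2 del, 0 < del & forall u u',
      d (set_val u) (set_val u') < del -> dY (F u) (F u') < e'.
Proof.
move=> [_ Yr] dYm dYd dYe dY1 dm dd d1 Bc f1.
pose Zu : uniformType := metric_space dm.
have de : metrizes (d : Zu -> Zu -> R) := @metric_space_metrizes R Z d dm.
pose W := @adjunction_space Zu Y B f.
pose dW : W -> W -> R := @adjunction_dist R Zu Y B f d dY.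
have dWm : pmetric dW by exact: adjunction_dist_pmetric.
have dWd : definite dW by exact: adjunction_dist_definite.
have dWe : metrizes dW by exact: adjunction_dist_metrizes.
pose D := glue_dist d dY (@set_val Zu B) f.
have dW_pi u v : dW (\pi_W u) (\pi_W v) = D u v by exact: adjunction_dist_pi.
have Dm : pmetric D by exact: glue_dist_pmetric.
pose i (y : Y) : W := \pi_W (inr y).
have diE y y' : dW (i y) (i y') = dY y y'.
  by rewrite dW_pi /D glue_dist_inr.
have iI : injective i by move=> y y' ii; apply: dYd; rewrite -diE ii (pm_xx dWm).
have iuc : unif_continuous i.
  by apply/(metrizes_uc _ dYe dWe) => e e0; exists e => // y y' _ _; rewrite diE.
have iemb : uniform_embedding i.
  have yi (u : range i) : exists y, i y = set_val u.
    by have [y _ yE] := set_valP u; exists y.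
  split => //; exists (fun u => projT1 (cid (yi u))); last first.
    by move=> u; exact: (projT2 (cid (yi u))).
  apply/(metrizes_uc _ (metrizes_set_type (B := range i) dWe) dYe) => e e0.
  exists e => // u u' _ _; rewrite -diE.
  by rewrite (projT2 (cid (yi u))) (projT2 (cid (yi u'))).
have rB : range (@set_val Zu B) = B.
  apply/seteqP; split => [_ [u _ <-]|z Bz]; first exact: set_valP.
  by exists (exist _ z (mem_set Bz)).
have icl : closed (range i).
  apply/(metrizes_closed _ dWe) => w hw.
  have w0 : sdist D (range inr) (repr w) = 0.
    apply/eqP; rewrite eq_le (sdist_ge0 Dm) andbT; apply/ler_addgt0Pr => e e0.
    rewrite add0r; have [_ [y _ <-] wy] := hw e e0.
    have := sdist_le Dm (repr w) (b := inr y) (B := range inr).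
    move=> /(_ (ex_intro2 _ _ y I erefl)) /le_trans -> //.
    by rewrite -dW_pi reprK ltW.
  have [y wy] : exists y, D (repr w) (inr y) = 0.
    by apply: sdist_inr_eq0 => //; rewrite rB.
  exists y => //; apply: dWd; rewrite (pm_sym dWm) /i.
  by move: wy; rewrite -dW_pi reprK.
have Wr := Yr W i (ex_intro _ dW (proj2 (compatible_metricP dW) (And3 dWm dWd dWe)))
  iemb icl.
have [G [e [e0 GC Guc GU]]] := proj1 (uniform_retractP b (range i) dWm dWd dWe) Wr.
have dinl z z' : dW (\pi_W (inl z)) (\pi_W (inl z')) <= d z z'.
  by rewrite dW_pi; exact: glue_dist_inl.
have gluei (v : set_type B) : \pi_W (inl (set_val v)) = i (f v).
  by apply: dWd; rewrite dW_pi; exact: glue_dist_glue.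
have nU (u : set_type (mnbhd b d B e)) :
    mnbhd b dW (range i) e (\pi_W (inl (set_val u))).
  case: (set_valP u) => [bT|[y By zy]]; [by left|right].
  exists (i (f (exist _ y (mem_set By)))); first by exists (f (exist _ y (mem_set By))).
  by rewrite -gluei; apply: le_lt_trans (dinl _ _) zy.
have GY (u : set_type (mnbhd b d B e)) :
    exists y, i y = G (\pi_W (inl (set_val u))).
  by have [y _ yE] := GU _ (nU u); exists y.
exists e => //; exists (fun u => projT1 (cid (GY u))); split => [u v uv|].
  apply: iI; rewrite (projT2 (cid (GY u))) uv gluei.
  by apply: dWd; apply: GC; exists (f v).
move=> e' /Guc[del del0 h]; exists del => // u u' uu'.
rewrite -diE (projT2 (cid (GY u))) (projT2 (cid (GY u'))).
by apply: h => //; exact: le_lt_trans (dinl _ _) uu'.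
Qed.

(** The extension to a point of the empty map provides an element. *)
Lemma absolute_retract_inhabited (Y : uniformType) :
  absolute_retract true Y -> exists y : Y, True.
Proof.
move=> Yr; have [dY [dYm dYd dYe dY1]] := bounded_metric Yr.1.
pose f (u : set_type (set0 : set unit)) : Y := False_rect Y (set_valP u).
have [|||||e _ [F _]] := @absolute_retract_extends true Y dY unit (fun _ _ => 0)
  set0 f Yr dYm dYd dYe dY1.
- by split=> // *; rewrite addr0.
- by move=> [] [].
- by move=> _ _; exact: ler01.
- by move=> z /(_ 1 ltr01)[].
- by move=> u; case: (set_valP u).
have U : mnbhd true (fun _ _ : unit => 0 : R) set0 e tt by left.
by exists (F (exist _ tt (mem_set U))).
Qed.

Lemma absolute_retract_extensor b (Y : uniformType) (T : Type)
    (dT : T -> T -> R) (inj : Y -> T) :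
  absolute_retract b Y -> pmetric dT -> definite dT ->
  (forall x y, dT x y <= 1) -> injective inj ->
  metrizes (fun y y' => dT (inj y) (inj y')) ->
  extensor b dT (range inj).
Proof.
move=> Yr dTm dTd dT1 injI dYe.
apply: extensor_lipschitz => // [bT|Z d B g dm dd d1 Bc gL gB].
  rewrite bT in Yr; have [y _] := absolute_retract_inhabited Yr.
  by exists (inj y), y.
have gy (u : set_type B) : exists y, inj y = g (set_val u).
  by have [y _ yE] := gB _ (set_valP u); exists y.
pose f u := projT1 (cid (gy u)).
have fE u : inj (f u) = g (set_val u) := projT2 (cid (gy u)).
pose dY y y' := dT (inj y) (inj y').
have dYm : pmetric dY.
  by split=> *; [exact: (pm_xx dTm)|exact: (pm_sym dTm)|exact: (pm_tri dTm)].
have dYd : definite dY by move=> y y' /dTd/injI.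
have f1 u u' : dY (f u) (f u') <= d (set_val u) (set_val u').
  by rewrite /dY !fE; apply: gL; exact: set_valP.
have [e e0 [F [FB Fuc]]] := absolute_retract_extends Yr dYm dYd dYe
  (fun y y' => dT1 _ _) dm dd d1 Bc f1.
pose U := mnbhd b d B e.
pose G z := match pselect (U z) with
            | left Uz => inj (F (exist _ z (mem_set Uz)))
            | right _ => g z
            end.
have GE z (Uz : z \in U) : G z = inj (F (exist _ z Uz)).
  rewrite /G; case: pselect => [Uz'|]; last by move=> /(_ (set_mem Uz)).
  by rewrite (Prop_irrelevance (mem_set Uz') Uz).
have BU z : B z -> z \in U.
  by move=> Bz; apply/mem_set; right; exists z => //; rewrite (pm_xx dm).
exists G, e; split => //.
- move=> z Bz; rewrite (GE z (BU z Bz)) (FB _ (exist _ z (mem_set Bz))) //.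
  by rewrite fE (pm_xx dTm).
- move=> e' /Fuc[del del0 h]; exists del => // z z' /mem_set Uz /mem_set Uz' zz'.
  by rewrite (GE z Uz) (GE z' Uz'); exact: h.
- by move=> z /mem_set Uz; rewrite (GE z Uz); exists (F (exist _ z Uz)).
Qed.

(** The inverse of an embedding extends; composing with the embedding gives a
    retraction. *)
Lemma extensor_absolute_retract b (W : uniformType) (dW : W -> W -> R) :
  pmetric dW -> definite dW -> metrizes dW -> extensor b dW setT ->
  absolute_retract b W.
Proof.
move=> dWm dWd dWe [Wn Wext]; split.
  by exists dW; apply/compatible_metricP.
move=> Z i [d /compatible_metricP[dm dd de]] [iI iuc [g guc gE]] icl.
apply/(uniform_retractP b (range i) dm dd de).
move/(metrizes_uc _ dWe de) : iuc => iuc.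
move/(metrizes_uc _ (metrizes_set_type (B := range i) de) dWe) : guc => guc.
have [[w0 _]|noW] := pselect (exists w : W, True); last first.
  have nC z : ~ range i z by move=> [w _ _]; apply: noW; exists w.
  have nU z : ~ mnbhd b d (range i) 1 z.
    by move=> [/Wn[w _]|[y /nC]] //; apply: noW; exists w.
  exists id, 1; split => // [z /nC//|e e0|z /nU//].
  by exists 1 => // z z' /nU.
pose g0 z := match pselect (range i z) with
             | left h => g (exist _ z (mem_set h))
             | right _ => w0
             end.
have g0E z (h : z \in range i) : g0 z = g (exist _ z h).
  rewrite /g0; case: pselect => [h'|]; last by move=> /(_ (set_mem h)).
  by rewrite (Prop_irrelevance (mem_set h') h).
have g0uc : uc_on d dW (range i) g0.
  move=> e /guc[del del0 h]; exists del => // z z' /mem_set Cz /mem_set Cz' zz'.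
  by rewrite (g0E z Cz) (g0E z' Cz'); exact: h.
have Bc := proj1 (metrizes_closed _ de) icl.
have [G [e [e0 GB Guc _]]] := Wext Z d (range i) g0 dm dd Bc g0uc (fun _ _ => I).
exists (i \o G), e; split => //.
- move=> z Cz; rewrite /= (dWd _ _ (GB z Cz)).
  by rewrite (g0E z (mem_set Cz)) gE /= (pm_xx dm).
- move=> e' /iuc[del del0 h] /=; have [del' del'0 h'] := Guc del del0.
  by exists del' => // z z' Uz Uz' zz'; apply: h => //; exact: h'.
Qed.

(** The projection of [X + Y] preserves distances, so that extension problems for
    the adjunction space lift along representatives. *)
Lemma adjunction_absolute_retract b (X Y : uniformType) (A : set X)
    (f : set_type A -> Y) : closed A -> unif_continuous f ->
  absolute_retract b X -> absolute_retract b Y -> absolute_retract b (set_type A) ->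
  absolute_retract b (adjunction_space f).
Proof.
move=> Acl fc Xr Yr Ar.
have [d [dY [[dm dd de d1] [dYm dYd dYe dY1] f1]]] := lipschitz_metrics Xr.1 Yr.1 fc.
have Ac := proj1 (metrizes_closed _ de) Acl.
have idE (T : Type) : range (@id T) = setT.
  by apply/seteqP; split => // x _; exists x.
have Xext : extensor b d setT.
  by rewrite -idE; apply: absolute_retract_extensor.
have Yext : extensor b dY setT.
  by rewrite -idE; apply: absolute_retract_extensor.
have Aext : extensor b d (range (@set_val X A)).
  apply: (absolute_retract_extensor Ar dm dd d1) => [u v uv|].
    exact: val_inj.
  exact: metrizes_set_type.
have rA : range (@set_val X A) = A.
  apply/seteqP; split => [_ [u _ <-]|z Az]; first exact: set_valP.
  by exists (exist _ z (mem_set Az)).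
have [Dn Dext] : extensor b (glue_dist d dY (@set_val X A) f) setT.
  by apply: glue_extensor => //; rewrite rA.
have dW_pi u v : adjunction_dist d dY (\pi_(adjunction_space f) u)
    (\pi_(adjunction_space f) v) = glue_dist d dY (@set_val X A) f u v.
  exact: adjunction_dist_pi.
apply: (@extensor_absolute_retract _ _ (adjunction_dist d dY)).
- exact: adjunction_dist_pmetric.
- exact: adjunction_dist_definite.
- exact: adjunction_dist_metrizes.
split; first by move=> /Dn[u _]; exists (\pi_(adjunction_space f) u).
move=> Z dZ B g dZm dZd Bc guc _.
have [G [e [e0 GB Guc _]]] := Dext Z dZ B (fun z => repr (g z)) dZm dZd Bc guc
  (fun _ _ => I).
exists (fun z => \pi_(adjunction_space f) (G z)), e; split => //.
  by move=> z Bz; rewrite -[g z]reprK dW_pi; exact: GB.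
move=> e' /Guc[del del0 h]; exists del => // z z' Uz Uz' zz'.
by rewrite dW_pi; exact: h.
Qed.

End UniformRetracts.

Theorem theorem14p1 (R : realType) (X Y : uniformType) (A : set X)
    (f : set_type A -> Y) (closedA : closed A) (fc : unif_continuous f) :
  (uniform_AR R X -> uniform_AR R Y -> uniform_AR R (set_type A) ->
     uniform_AR R (adjunction_space f)) /\
  (uniform_ANR R X -> uniform_ANR R Y -> uniform_ANR R (set_type A) ->
     uniform_ANR R (adjunction_space f)).
Proof.
split.
  exact: (adjunction_absolute_retract (b := true) closedA fc).
exact: (adjunction_absolute_retract (b := false) closedA fc).
Qed.
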